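(* Let $\nu>0$ and consider the equation $$h_t=(h_x^3-h_x)_x-\nu h_{xxxx}$$ with $2\pi$-periodic boundary condition. There exists a nonempty family $\mathcal A$ of smooth initial data on $\mathbb T$ such that the following holds: (1) For any $h_0\in\mathcal A$, $\int_{\mathbb T}h_0(x)\,dx=0$ and $\|\partial_xh_0\|_\infty<1$. (2) For any $h_0\in\mathcal A$, there exists $t_0>0$ (depending on $h_0$) such that the solution $h$ with initial data $h_0$ satisfies $$\|\partial_xh(t_0,\cdot)\|_\infty>1 .$$
   Context: $\mathbb T=\mathbb R/2\pi\mathbb Z$; functions are real-valued; $\|\cdot\|_\infty$ is the $L^\infty(\mathbb T)$ norm. For smooth mean-zero $h_0$ the solution is the unique global one given by the mild formulation $h(t)=e^{-\nu t\partial_x^4}h_0+\int_0^t\partial_xe^{-\nu(t-s)\partial_x^4}(h_x^3-h_x)(s)\,ds$, where $e^{-\nu t\partial_x^4}$ is the Fourier multiplier $e^{-\nu tk^4}$, with $h\in C_t^0H_x^{1/2}$, $t^{1/4}h_x\in C_t^0C_x^0$, $t^{1/4}h\in C_t^0H_x^{3/2}$ on every $[0,T]$; it is smooth. *)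

(* Defs.v *)
From HB Require Import structures.
From mathcomp Require Import all_boot all_order all_algebra.
From mathcomp Require Import all_classical all_reals all_analysis.

Set Implicit Arguments.
Unset Strict Implicit.
Unset Printing Implicit Defensive.

Import Order.TTheory GRing.Theory Num.Theory.
Import numFieldNormedType.Exports.

Local Open Scope classical_set_scope.
Local Open Scope ring_scope.

(* A function on the circle R / 2 pi Z is a 2 pi-periodic function on R; a
   function of time and space is t |-> (x |-> h t x), used for t >= 0 only. *)
Definition circle_fun (R : realType) (f : R -> R) : Prop :=
  periodic f (pi *+ 2).

Definition circle_int (R : realType) (f : R -> R) : R :=
  \int[@lebesgue_measure R]_(x in `[0, pi *+ 2]) f x.

(* For a periodic f, the essential supremum of |f| over the whole line is the
   essential supremum over one period, i.e. over the circle. *)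
Definition Linf_norm (R : realType) (f : R -> R) : \bar R :=
  ('N[@lebesgue_measure R]_+oo[EFin \o f])%E.

Definition smooth (R : realType) (f : R -> R) : Prop :=
  forall (n : nat) (x : R), derivable (derive1n n f) x 1.

(* With the Fourier coefficients f^(k) = (2 pi)^-1 \int f(x) e^{-ikx} dx of a
   real-valued f, one has f^(k) = fcos f k - i fsin f k and
   f^(-k) = fcos f k + i fsin f k for every natural number k. *)
Definition fcos (R : realType) (f : R -> R) (k : nat) : R :=
  (pi *+ 2)^-1 * circle_int (fun x => f x * cos (k%:R * x)).

Definition fsin (R : realType) (f : R -> R) (k : nat) : R :=
  (pi *+ 2)^-1 * circle_int (fun x => f x * sin (k%:R * x)).

(* The number of integers j with |j| = k: sums over integer frequencies are
   written below as sums over k = |j|. *)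
Definition nfreq (k : nat) : nat := if k is 0%N then 1%N else 2%N.

(* \sum_(j : int, |j| = k) f^(j) e^{ijx} *)
Definition fmode (R : realType) (f : R -> R) (k : nat) (x : R) : R :=
  (nfreq k)%:R * (fcos f k * cos (k%:R * x) + fsin f k * sin (k%:R * x)).

(* e^{- nu t d_x^4} f: the Fourier multiplier with symbol e^{- nu t j^4} *)
Definition biharmonic_semigroup (R : realType) (nu t : R) (f : R -> R)
    (x : R) : R :=
  limn (series (fun k : nat => expR (- (nu * t * k%:R ^+ 4)) * fmode f k x)).

(* (\sum_(j : int) (1 + j^2)^s |f^(j)|^2)^(1/2) *)
Definition Hs_norm (R : realType) (s : R) (f : R -> R) : \bar R :=
  ((\sum_(0 <= k <oo)
     ((1 + k%:R ^+ 2) `^ s *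
      ((nfreq k)%:R * (fcos f k ^+ 2 + fsin f k ^+ 2)))%:E) `^ 2^-1)%E.

Definition Hs (R : realType) (s : R) : set (R -> R) :=
  [set f | [/\ circle_fun f,
               measurable_fun setT f,
               (\int[@lebesgue_measure R]_(x in `[0%R, (pi *+ 2)%R])
                   (f x ^+ 2)%:E < +oo)%E
             & (Hs_norm s f < +oo)%E]].

Definition C0 (R : realType) : set (R -> R) :=
  [set f | circle_fun f /\ continuous f].

(* w belongs to C([0, T]; X), where N is the norm of X *)
Definition Ct (R : realType) (X : set (R -> R)) (N : (R -> R) -> \bar R)
    (T : R) (w : R -> R -> R) : Prop :=
  forall t : R, t \in `[0, T] ->
    X (w t) /\
    N (w s \- w t) @[s --> within `[0, T] (nbhs t)] --> 0%E.

(* The initial condition is the mild formulation at t = 0. Since 0 `^ 4^-1 = 0,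
   the time-weighted functions vanish at t = 0. *)
Record mild_solution (R : realType) (nu : R) (h0 : R -> R) (h : R -> R -> R)
    : Prop := MildSolution {
  mild_init : h 0 = h0 ;
  mild_derivable : forall t x : R, 0 <= t -> derivable (h t) x 1 ;
  mild_duhamel : forall t x : R, 0 < t ->
    h t x = biharmonic_semigroup nu t h0 x +
      \int[@lebesgue_measure R]_(s in `[0, t])
        derive1 (biharmonic_semigroup nu (t - s)
                   (fun y => derive1 (h s) y ^+ 3 - derive1 (h s) y)) x ;
  mild_H12 : forall T : R, 0 < T ->
    Ct (Hs 2^-1) (Hs_norm 2^-1) T h ;
  mild_C1 : forall T : R, 0 < T ->
    Ct (@C0 R) (@Linf_norm R) T (fun t x => t `^ 4^-1 * derive1 (h t) x) ;
  mild_H32 : forall T : R, 0 < T ->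
    Ct (Hs (3 / 2)) (Hs_norm (3 / 2)) T (fun t x => t `^ 4^-1 * h t x)
}.

(* Main.v *)
Require Import Defs.
From mathcomp Require Import all_boot all_order all_algebra.
From mathcomp Require Import all_classical all_reals all_analysis.
From mathcomp Require Import measurable_realfun ess_sup_inf ring lra.
Import Order.TTheory GRing.Theory Num.Theory.
Import numFieldNormedType.Exports.
Local Open Scope classical_set_scope.
Local Open Scope ring_scope.

(** The slope u = h_x solves u_t = (u^3 - u)_xx - nu u_xxxx, and a fourth-order
equation has no maximum principle.  Take u(0) = lam (3c - c^3)/2 with
c = cos x: its maximum, at x = 0, is lam, and it is so flat there that
u_xx = 0 while u_xxxx = - 9 lam.  At x = 0 and time 0 the nonlinear term
(3 u^2 - 1) u_xx + 6 u u_x^2 vanishes, so that u_t = 9 nu lam > 0.  If this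
growth persists up to a time t that does not depend on lam in [1/2, 1], then
lam = 1 - nu t gives data of slope less than 1 and u(t, 0) > 1.  The family of
data consists of this single function [height0 (1 - nu * t)].

What has to be proved is that the growth persists, uniformly in lam, for every
mild solution; the a priori information on u is that t^(1/4) u is continuous
in time with values in C^0.  Differentiating the Duhamel formula ([duhamel_slope]) gives
u(t) = (S(t) h0)_x + \int_0^t d_xx S(t - s) (u^3 - u)(s) ds, and everything
rests on the bound |d_xx S(s) f| <= C s^(-1/2) sup |f| ([normr_ddsemigroup],
[ddsemigroup_smoothing]), which follows from the boundedness of Fejer means by
summing by parts twice ([normr_fejer_mean], [abel_twice],
[second_difference]).  The bound is used three times.

- The cubic term is critical: when t^(1/4) |u| <= m, the integral is at most
  C (m^3 + m t^(1/2)) t^(-1/4).  Since t^(1/4) u is continuous and vanishes at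
  t = 0, a continuity argument in time keeps m of the order of t^(1/4) up to a
  time that depends on nu only ([wslope_bounded]), so that u is bounded
  ([slope_bounded]).
- Comparing u^3 - u with its value at time 0, a trigonometric polynomial,
  yields |u(t) - u(0)| <= K t ([slope_near_slope0]).
- At x = 0 the contribution of the initial value of u^3 - u to the integral
  is O(t^2), because (u^3 - u)_xx vanishes there; the remaining part of the
  integral is O(t^(3/2)).  Hence u(t, 0) = lam (1 + 9 nu t) + O(t^(3/2))
  ([slope_at0], [slope_lin0_ge]), which exceeds 1 for a suitable t
  ([overshoot]). *)

Set Implicit Arguments.
Unset Strict Implicit.
Unset Printing Implicit Defensive.

(** * Integrals over the circle *)

Section CircleInt.
Context {R : realType}.
Implicit Types (f g : R -> R) (x w : R).
Local Notation mu := (@lebesgue_measure R).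

Lemma circle_integrable f : continuous f ->
  mu.-integrable `[0, pi *+ 2] (EFin \o f).
Proof.
move=> cf; apply: continuous_compact_integrable; first exact: segment_compact.
exact: continuous_subspaceT.
Qed.

Lemma circle_intD f g : continuous f -> continuous g ->
  circle_int (fun z => f z + g z) = circle_int f + circle_int g.
Proof. by move=> cf cg; apply: RintegralD => //; exact: circle_integrable. Qed.

Lemma circle_intZ a f : continuous f ->
  circle_int (fun z => a * f z) = a * circle_int f.
Proof. by move=> cf; apply: RintegralZl => //; exact: circle_integrable. Qed.

Lemma le_circle_int f g : continuous f -> continuous g ->
  (forall z, f z <= g z) -> circle_int f <= circle_int g.
Proof. by move=> cf cg fg; apply: le_Rintegral => //; exact: circle_integrable. Qed.

Lemma circle_int_cst a : circle_int (fun=> a : R) = a * (pi *+ 2).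
Proof.
rewrite /circle_int Rintegral_cst//=. rewrite lebesgue_measure_itv/= lte_fin.
by rewrite pmulrn_lgt0// pi_gt0 sube0.
Qed.

Lemma normr_circle_int f g : continuous f -> continuous g ->
  (forall z, `|f z| <= g z) -> `|circle_int f| <= circle_int g.
Proof.
move=> cf cg fg; rewrite ler_norml; apply/andP; split; last first.
  by apply: le_circle_int => // z; apply: le_trans (fg z); exact: ler_norm.
have cN : continuous (fun z => -1 * f z).
  by move=> z; apply: cvgM; [exact: cvg_cst|exact: cf].
rewrite lerNl -mulN1r -circle_intZ//; apply: le_circle_int => // z.
by rewrite mulN1r; apply: le_trans (fg z); rewrite -normrN; exact: ler_norm.
Qed.

Lemma continuous_affine a x : continuous (fun z : R => a * (x - z)).
Proof.
move=> z; apply: cvgM; first exact: cvg_cst.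
by apply: cvgB; [exact: cvg_cst|exact: cvg_id].
Qed.

Lemma continuous_cos_affine a x : continuous (fun z : R => cos (a * (x - z))).
Proof.
move=> z; apply: (@continuous_comp _ _ _ (fun z => a * (x - z)) cos).
  exact: continuous_affine.
exact: continuous_cos.
Qed.

Lemma sin_natpi k x : sin (x - k%:R * (pi *+ 2)) = sin x.
Proof.
rewrite -[in RHS](subrK (k%:R * (pi *+ 2)) x) mulr_natl.
by rewrite (periodicn (@sinD2pi R)).
Qed.

(** Translates of the cosine are all needed, since the Fourier modes of a
function are its convolutions with cosines; they spare any shift of the domain of integration. *)
Lemma circle_int_cos k x : (0 < k)%N ->
  circle_int (fun z => cos (k%:R * (x - z))) = 0.
Proof.
move=> k0; have k0' : k%:R != 0 :> R by rewrite pnatr_eq0 -lt0n.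
pose F z := - (k%:R^-1 * sin (k%:R * (x - z))).
have dF z : is_derive z (1 : R) F (cos (k%:R * (x - z))).
  rewrite /F; apply: is_derive_eq.
  by rewrite /GRing.scale/=; field.
suff H : (\int[mu]_(z in `[0%R, (pi *+ 2)%R]) (cos (k%:R * (x - z)))%:E =
    (F (pi *+ 2)%R)%:E - (F 0%R)%:E)%E.
  rewrite /circle_int /Rintegral H.
  rewrite -EFinB/= /F subr0 mulrBr sin_natpi; ring.
apply: (@continuous_FTC2 _ (fun z => cos (k%:R * (x - z)))).
- by rewrite pmulrn_lgt0// pi_gt0.
- by apply: continuous_subspaceT; exact: continuous_cos_affine.
- have cF z : {for z, continuous F}.
    apply: differentiable_continuous; apply/derivable1_diffP.
    by have [] := dF z.
  split=> //.
  + by apply: cvg_at_right_filter; exact: cF.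
  + by apply: cvg_at_left_filter; exact: cF.
- by move=> z _; rewrite derive1E; apply: derive_val.
Qed.

End CircleInt.

(** * Fejer means *)

Section Fejer.
Context {R : realType}.
Implicit Types (f g : R -> R) (x w B : R) (c : nat -> R).

Lemma continuous_big_sum n (F : nat -> R -> R) :
  (forall k, continuous (F k)) -> continuous (fun z => \sum_(0 <= k < n) F k z).
Proof.
move=> cF; elim: n => [|n IHn] z.
  by under eq_fun do rewrite big_geq//; exact: cvg_cst.
under eq_fun do rewrite big_nat_recr//=.
by apply: cvgD; [exact: IHn|exact: cF].
Qed.

Lemma continuous_mulr f g : continuous f -> continuous g ->
  continuous (fun z => f z * g z).
Proof. by move=> cf cg z; apply: cvgM; [exact: cf|exact: cg]. Qed.

Lemma fmodeE f k x : continuous f -> fmode f k x =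
  (pi *+ 2)^-1 * circle_int (fun z => f z * ((nfreq k)%:R * cos (k%:R * (x - z)))).
Proof.
move=> cf; rewrite /fmode /fcos /fsin.
have c1 : continuous (fun z => f z * cos (k%:R * z)).
  apply: continuous_mulr => // z; apply: continuous_comp; last exact: continuous_cos.
  exact: mulrl_continuous.
have c2 : continuous (fun z => f z * sin (k%:R * z)).
  apply: continuous_mulr => // z; apply: continuous_comp; last exact: continuous_sin.
  exact: mulrl_continuous.
have cc (a : R) (h : R -> R) : continuous h -> continuous (fun z => a * h z).
  by move=> ch; apply: continuous_mulr => // z; exact: cvg_cst.
have -> : (fun z => f z * ((nfreq k)%:R * cos (k%:R * (x - z)))) =
    (fun z => (nfreq k)%:R * cos (k%:R * x) * (f z * cos (k%:R * z)) +
      (nfreq k)%:R * sin (k%:R * x) * (f z * sin (k%:R * z))).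
  by apply/funext => z; rewrite mulrBr cosB; ring.
rewrite circle_intD ?circle_intZ//; [ring| |]; exact: cc.
Qed.

Lemma sum_fmodeE f c n x : continuous f ->
  \sum_(0 <= k < n) c k * fmode f k x =
  (pi *+ 2)^-1 * circle_int (fun z => f z *
    \sum_(0 <= k < n) c k * ((nfreq k)%:R * cos (k%:R * (x - z)))).
Proof.
move=> cf.
have ccos a k : continuous (fun z => a * ((nfreq k)%:R * cos (k%:R * (x - z)))).
  apply: continuous_mulr; first by move=> z; exact: cvg_cst.
  apply: continuous_mulr; first by move=> z; exact: cvg_cst.
  exact: continuous_cos_affine.
elim: n => [|n IHn].
  rewrite big_geq// (_ : (fun _ => _) = fun=> 0) ?circle_int_cst ?mul0r ?mulr0//.
  by apply/funext => z; rewrite big_geq// mulr0.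
rewrite big_nat_recr//= IHn fmodeE// mulrCA -mulrDr -circle_intZ; last first.
  by apply: continuous_mulr => // z; have := ccos 1 n z; under eq_fun do rewrite mul1r.
rewrite -circle_intD.
- congr (_ * circle_int _); apply/funext => z.
  by rewrite big_nat_recr//=; ring.
- by apply: continuous_mulr => //; apply: continuous_big_sum => k; exact: ccos.
- apply: continuous_mulr; first by move=> z; exact: cvg_cst.
  by apply: continuous_mulr => // z; have := ccos 1 n z; under eq_fun do rewrite mul1r.
Qed.

Definition dirichlet n w : R := \sum_(0 <= k < n.+1) (nfreq k)%:R * cos (k%:R * w).

(** This is |\sum_(j < n) e^{ijw}|^2, that is, n times the Fejer kernel; in this
form it is visibly nonnegative. *)
Definition fejer n w : R :=
  (\sum_(0 <= j < n) cos (j%:R * w)) ^+ 2 + (\sum_(0 <= j < n) sin (j%:R * w)) ^+ 2.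

Lemma fejer_ge0 n w : 0 <= fejer n w.
Proof. by rewrite addr_ge0// sqr_ge0. Qed.

(** The new terms of the square of \sum_(j <= n) e^{ijw} are
1 + 2 \sum_(j < n) cos ((n - j) w). *)
Lemma fejerE n w : fejer n w = \sum_(0 <= m < n) dirichlet m w.
Proof.
elim: n => [|n IHn]; first by rewrite /fejer !big_geq// expr0n/= addr0.
rewrite big_nat_recr//= -IHn /fejer !(big_nat_recr n)//=.
suff -> : dirichlet n w = 1 + 2 * ((\sum_(0 <= j < n) cos (j%:R * w)) * cos (n%:R * w)
   + (\sum_(0 <= j < n) sin (j%:R * w)) * sin (n%:R * w)).
  by have := cos2Dsin2 (n%:R * w); lra.
rewrite /dirichlet big_nat_recl//= mul0r cos0 mulr1; congr (_ + _).
rewrite -mulr_sumr; congr (_ * _).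
rewrite !mulr_suml -big_split/= big_nat_rev/= add0n.
apply: eq_big_nat => j /andP[_ jn].
rewrite -cosN -(cosB (j%:R * w)) -mulrBl -mulNr; congr (cos (_ * _)).
have -> : (n - j.+1).+1 = (n - j)%N by rewrite subnSK.
by rewrite natrB 1?ltnW// opprB.
Qed.

(** The kernel is nonnegative and has mean n, so convolving with it multiplies
the supremum by at most n.  Dirichlet sums alone would lose a logarithm. *)
Lemma normr_fejer_mean f B n x : continuous f -> (forall z, `|f z| <= B) ->
  `|\sum_(0 <= m < n) \sum_(0 <= k < m.+1) fmode f k x| <= n%:R * B.
Proof.
move=> cf fB.
have cD m : continuous (fun z => dirichlet m (x - z)).
  apply: continuous_big_sum => k.
  apply: continuous_mulr; first by move=> z; exact: cvg_cst.
  exact: continuous_cos_affine.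
have cF m : continuous (fun z => fejer m (x - z)).
  rewrite (_ : (fun _ => _) = fun z => \sum_(0 <= j < m) dirichlet j (x - z)).
    exact: continuous_big_sum.
  by apply/funext => z; rewrite fejerE.
have pi2 : 0 < pi *+ 2 :> R by rewrite pmulrn_lgt0// pi_gt0.
have cst (a : R) : continuous (fun _ : R => a) by move=> z; exact: cvg_cst.
have mD m : circle_int (fun z => dirichlet m (x - z)) = pi *+ 2.
  elim: m => [|m IHm].
    rewrite (_ : (fun _ => _) = fun=> 1) ?circle_int_cst ?mul1r//.
    by apply/funext => z; rewrite /dirichlet big_nat1 mul0r cos0 mulr1.
  rewrite -[RHS]addr0 -[X in _ = _ + X](mulr0 2) -[in RHS](@circle_int_cos _ m.+1 x)//.
  rewrite -IHm -circle_intZ; last exact: continuous_cos_affine.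
  rewrite -circle_intD//; last by apply: continuous_mulr => //; exact: continuous_cos_affine.
  by congr circle_int; apply/funext => z; rewrite /dirichlet big_nat_recr//=.
have mF m : circle_int (fun z => fejer m (x - z)) = m%:R * (pi *+ 2).
  elim: m => [|m IHm].
    rewrite (_ : (fun _ => _) = fun=> 0) ?circle_int_cst ?mul0r//.
    by apply/funext => z; rewrite fejerE big_geq.
  rewrite -natr1 mulrDl mul1r -[X in _ + X](mD m) -IHm -circle_intD//.
  by congr circle_int; apply/funext => z; rewrite !fejerE big_nat_recr.
have -> : \sum_(0 <= m < n) \sum_(0 <= k < m.+1) fmode f k x =
    (pi *+ 2)^-1 * circle_int (fun z => f z * fejer n (x - z)).
  elim: n => [|n IHn].
    rewrite big_geq// (_ : (fun _ => _) = fun=> 0) ?circle_int_cst ?mul0r ?mulr0//.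
    by apply/funext => z; rewrite fejerE big_geq// mulr0.
  rewrite big_nat_recr//= IHn.
  have -> : \sum_(0 <= k < n.+1) fmode f k x =
      (pi *+ 2)^-1 * circle_int (fun z => f z * dirichlet n (x - z)).
    have := sum_fmodeE (fun=> 1) n.+1 x cf.
    rewrite (eq_bigr (fun k => fmode f k x)) => [->|k _]; last by rewrite mul1r.
    congr (_ * circle_int _); apply/funext => z; congr (_ * _).
    by apply: eq_bigr => k _; rewrite mul1r.
  rewrite -mulrDr -circle_intD; [|exact: continuous_mulr..].
  congr (_ * circle_int _); apply/funext => z.
  by rewrite !fejerE big_nat_recr//= mulrDr.
rewrite normrM gtr0_norm ?invr_gt0// mulrC ler_pdivrMr//.
rewrite mulrAC -mF mulrC -circle_intZ//.
apply: normr_circle_int; [exact: continuous_mulr|exact: continuous_mulr|move=> z].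
by rewrite normrM (ger0_norm (fejer_ge0 _ _)) ler_wpM2r// fejer_ge0.
Qed.

Lemma normr_fcos f B k : continuous f -> (forall z, `|f z| <= B) -> `|fcos f k| <= B.
Proof.
move=> cf fB; have B0 : 0 <= B by exact: le_trans (fB 0).
have pi2 : 0 < pi *+ 2 :> R by rewrite pmulrn_lgt0// pi_gt0.
rewrite /fcos normrM gtr0_norm ?invr_gt0// mulrC ler_pdivrMr// -circle_int_cst.
apply: normr_circle_int.
- apply: continuous_mulr => // z; apply: continuous_comp; last exact: continuous_cos.
  exact: mulrl_continuous.
- by move=> z; exact: cvg_cst.
- by move=> z; rewrite normrM -[leRHS]mulr1 ler_pM// cos_max.
Qed.

Lemma normr_fsin f B k : continuous f -> (forall z, `|f z| <= B) -> `|fsin f k| <= B.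
Proof.
move=> cf fB; have B0 : 0 <= B by exact: le_trans (fB 0).
have pi2 : 0 < pi *+ 2 :> R by rewrite pmulrn_lgt0// pi_gt0.
rewrite /fsin normrM gtr0_norm ?invr_gt0// mulrC ler_pdivrMr// -circle_int_cst.
apply: normr_circle_int.
- apply: continuous_mulr => // z; apply: continuous_comp; last exact: continuous_sin.
  exact: mulrl_continuous.
- by move=> z; exact: cvg_cst.
- by move=> z; rewrite normrM -[leRHS]mulr1 ler_pM// sin_max.
Qed.

End Fejer.

(** * Decay and second differences of the symbol *)

Section Estimates.
Context {R : realType}.
Implicit Types (r x y : R).

Lemma is_derive_continuous (f df : R -> R) :
  (forall x, is_derive x 1 f (df x)) -> continuous f.
Proof.
move=> dF x; apply: differentiable_continuous; apply/derivable1_diffP.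
by have [] := dF x.
Qed.

Lemma mean_value (f df : R -> R) a b : a < b ->
  (forall x, is_derive x 1 f (df x)) ->
  exists2 c, a < c < b & f b - f a = df c * (b - a).
Proof.
move=> ab dF; have [c] : exists2 c, c \in `]a, b[%R & f b - f a = df c * (b - a).
  apply: MVT => //; by apply: continuous_subspaceT; exact: is_derive_continuous dF.
by rewrite in_itv/=; exists c.
Qed.

(** Telescoping: r / (1 + r k)^2 <= 1 / (1 + r (k - 1)) - 1 / (1 + r k).  For
r <= 1 the bound is of order 1 / r, the number of frequencies below 1 / r. *)
Lemma sum_inv_sqr_le r n : 0 < r ->
  \sum_(0 <= k < n) (1 + r * k%:R) ^- 2 <= 1 + r^-1.
Proof.
move=> r0; case: n => [|n].
  by rewrite big_geq// addr_ge0// invr_ge0 ltW.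
suff H : \sum_(0 <= k < n.+1) (1 + r * k%:R) ^- 2 <=
    1 + r^-1 * (1 - (1 + r * n%:R)^-1).
  apply: le_trans H _; rewrite lerD2l ger_pMr ?invr_gt0// gerBl invr_ge0.
  by rewrite addr_ge0// mulr_ge0// ltW.
elim: n => [|n IHn].
  by rewrite big_nat1 mulr0 addr0 expr1n invr1 subrr mulr0 addr0.
rewrite big_nat_recr//=; apply: le_trans (lerD IHn (lexx _)) _.
have n0 : 0 < 1 + r * n%:R by rewrite ltr_pwDl// mulr_ge0// ltW.
have -> : 1 + r * n.+1%:R = 1 + r * n%:R + r by rewrite -natr1; ring.
rewrite -[leLHS]addrA lerD2l.
set u := 1 + r * n%:R in n0 *.
have ur : 0 < u + r by rewrite addr_gt0.
rewrite -subr_ge0.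
have -> : r^-1 * (1 - (u + r)^-1) - (r^-1 * (1 - u^-1) + (u + r) ^- 2) =
    r / (u * (u + r) ^+ 2).
  by field; rewrite !gt_eqF.
by rewrite divr_ge0 ?ltW// mulr_gt0// exprn_gt0.
Qed.

Lemma quartic_le_expR y : 0 <= y -> (1 + y) ^+ 4 <= 16 * expR (y ^+ 4 / 2).
Proof.
move=> y0.
have e1 : 1 + y ^+ 4 / 2 <= expR (y ^+ 4 / 2) by exact: expR_ge1Dx.
apply: le_trans (ler_wpM2l _ e1) => //.
have : 0 <= (1 - y) ^+ 2 * (7 * (1 + y ^+ 2) + 10 * y).
  by rewrite mulr_ge0 ?sqr_ge0// !addr_ge0 ?mulr_ge0 ?addr_ge0 ?sqr_ge0.
by nra.
Qed.

Lemma expr_expR_le y j : 0 <= y -> (j <= 6)%N ->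
  y ^+ j * expR (- y ^+ 4) <= 256 * (1 + y) ^- 2.
Proof.
move=> y0 j6.
have y1 : 1 <= 1 + y by rewrite lerDl.
have yp : 0 < 1 + y by rewrite ltr_pwDl.
have H0 : 256 * expR (y ^+ 4) >= (1 + y) ^+ 8.
  have -> : y ^+ 4 = y ^+ 4 / 2 + y ^+ 4 / 2 by field.
  rewrite expRD.
  have h1 := quartic_le_expR y0.
  rewrite (_ : (1 + y) ^+ 8 = (1 + y) ^+ 4 * (1 + y) ^+ 4); last by rewrite -exprD.
  apply: le_trans (ler_pM _ _ h1 h1) _; [by rewrite exprn_ge0// ltW..|lra].
rewrite expRN ler_pdivrMr ?expR_gt0// mulrAC ler_pdivlMr ?exprn_gt0//.
apply: le_trans H0; rewrite (_ : 8 = 6 + 2)%N// exprD ler_wpM2r//.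
  by rewrite exprn_ge0// ltW.
apply: (@le_trans _ _ ((1 + y) ^+ j)); last exact: ler_weXn2l.
by apply: lerXn2r; rewrite ?nnegrE ?lerDr// ltW.
Qed.

(** The scale is r = (nu t)^(1/4): frequencies beyond 1 / r are damped, so a
factor k costs 1 / r, and the summable weight (1 + r k)^-2 is kept. *)
Lemma nat_expR_le r j k : 0 < r -> (j <= 6)%N ->
  k%:R ^+ j * expR (- (r ^+ 4 * k%:R ^+ 4)) <=
  256 / r ^+ j * (1 + r * k%:R) ^- 2.
Proof.
move=> r0 j6.
have := @expr_expR_le (r * k%:R) j (mulr_ge0 (ltW r0) (ler0n _ _)) j6.
rewrite !exprMn_comm; [|exact: mulrC..] => H.
rewrite [leRHS]mulrAC ler_pdivlMr ?exprn_gt0//; apply: le_trans H.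
by rewrite le_eqVlt; apply/orP; left; apply/eqP; ring.
Qed.

Lemma is_derive_sqr_expR s x : is_derive x 1
  (fun z : R => z ^+ 2 * expR (- (s * z ^+ 4)))
  ((2 * x - 4 * s * x ^+ 5) * expR (- (s * x ^+ 4))).
Proof. by apply: is_derive_eq; rewrite /GRing.scale/=; ring. Qed.

Lemma is_derive2_sqr_expR s x : is_derive x 1
  (fun z : R => (2 * z - 4 * s * z ^+ 5) * expR (- (s * z ^+ 4)))
  ((2 - 28 * (s * x ^+ 4) + 16 * (s * x ^+ 4) ^+ 2) * expR (- (s * x ^+ 4))).
Proof. by apply: is_derive_eq; rewrite /GRing.scale/=; ring. Qed.

Lemma second_derivative_bound y : 0 <= y ->
  `|(2 - 28 * y + 16 * y ^+ 2) * expR (- y)| <= 256 * expR (- (y / 2)).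
Proof.
move=> y0; rewrite normrM (ger0_norm (expR_ge0 _)).
have -> : - y = - (y / 2) + - (y / 2) by field.
rewrite expRD mulrA ler_wpM2r ?expR_ge0// expRN ler_pdivrMr ?expR_gt0//.
have e1 : 1 + y / 4 <= expR (y / 4) by exact: expR_ge1Dx.
have -> : y / 2 = y / 4 + y / 4 by field.
have e2 : (1 + y / 4) ^+ 2 <= expR (y / 4 + y / 4).
  by rewrite expRD expr2 ler_pM// addr_ge0// divr_ge0.
apply: (@le_trans _ _ (256 * (1 + y / 4) ^+ 2)); last exact: (ler_wpM2l (ler0n _ _) e2).
by rewrite ler_norml; apply/andP; split; nra.
Qed.

(** The symbol x^2 e^{-(rx)^4} has a bounded second derivative that decays beyond
1 / r, and k.+1 costs 1 / r.  Summing over k thus yields O(r^-2), the same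
order as the supremum of the symbol. *)
Lemma second_difference r k : 0 < r -> r <= 1 ->
  let a j := j%:R ^+ 2 * expR (- (r ^+ 4 * j%:R ^+ 4)) : R in
  k.+1%:R * `|a k - 2 * a k.+1 + a k.+2| <=
    4096 / r * (1 + r * k%:R) ^- 2.
Proof.
move=> r0 r1 /=.
pose a x := x ^+ 2 * expR (- (r ^+ 4 * x ^+ 4)).
rewrite -/(a k%:R) -/(a k.+1%:R) -/(a k.+2%:R).
pose a1 x := (2 * x - 4 * r ^+ 4 * x ^+ 5) * expR (- (r ^+ 4 * x ^+ 4)).
pose a2 x := (2 - 28 * (r ^+ 4 * x ^+ 4) + 16 * (r ^+ 4 * x ^+ 4) ^+ 2) *
  expR (- (r ^+ 4 * x ^+ 4)).
have da x : is_derive x 1 a (a1 x) by exact: is_derive_sqr_expR.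
have da1 x : is_derive x 1 a1 (a2 x) by exact: is_derive2_sqr_expR.
have db x : is_derive x 1 (fun z => a (z + 1) - a z) (a1 (x + 1) - a1 x).
  have db1 : is_derive x 1 (fun z => a (z + 1)) (a1 (x + 1)).
    by apply: is_derive_eq; rewrite addr0 mulr1.
  exact: is_deriveB.
have lt1 z : z < z + 1 :> R by rewrite ltrDl.
have [c /andP[kc ck] Ec] := mean_value (lt1 k%:R) db.
have [b /andP[cb bc] Eb] := mean_value (lt1 c) da1.
have b0 : 0 <= b by rewrite (le_trans _ (ltW cb))// (le_trans _ (ltW kc)).
have -> : a k%:R - 2 * a k.+1%:R + a k.+2%:R = a2 b.
  have e x : x + 1 - x = 1 :> R by rewrite addrAC subrr add0r.
  move: Ec Eb; rewrite !e !mulr1 => Ec Eb; rewrite -Eb -Ec -!natr1; ring.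
have p0 x : 0 <= x -> 0 <= r ^+ 4 * x ^+ 4.
  by move=> x0; rewrite mulr_ge0// exprn_ge0// ltW.
have y0 : 0 <= r * k%:R by rewrite mulr_ge0// ltW.
have yp : 0 < 1 + r * k%:R by rewrite ltr_pwDl.
have H : `|a2 b| <= 256 * expR (- ((r * k%:R) ^+ 4 / 2)).
  apply: le_trans (second_derivative_bound (p0 _ b0)) _.
  apply: (ler_wpM2l (ler0n _ _)); rewrite ler_expR lerN2 ler_pM2r ?invr_gt0// -exprMn lerXn2r//.
  - by rewrite nnegrE mulr_ge0// ltW.
  - by rewrite ler_wpM2l ?(ltW r0)// (le_trans (ltW kc))// ltW.
apply: le_trans (ler_wpM2l (ler0n _ _) H) _.
have h1 := quartic_le_expR y0.
rewrite expRN; move: (expR_gt0 ((r * k%:R) ^+ 4 / 2)) h1.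
set E := expR _ => E0 h1.
rewrite ler_pdivlMr ?exprn_gt0//.
have -> : k.+1%:R * (256 / E) * (1 + r * k%:R) ^+ 2 =
    k.+1%:R * 256 * (1 + r * k%:R) ^+ 2 / E by ring.
rewrite ler_pdivrMr// [leRHS]mulrAC ler_pdivlMr//.
apply: (@le_trans _ _ (256 * (1 + r * k%:R) ^+ 4)); last by lra.
have k1 : k.+1%:R * r <= 1 + r * k%:R by rewrite -natr1; nra.
have q1 : 1 <= 1 + r * k%:R by rewrite lerDl.
have q2 : (1 + r * k%:R) ^+ 2 * (1 + r * k%:R) <= (1 + r * k%:R) ^+ 4.
  by rewrite -exprSr ler_weXn2l.
apply: le_trans (ler_wpM2l (ler0n _ _) q2).
have : (1 + r * k%:R) ^+ 2 * (k.+1%:R * r) <= (1 + r * k%:R) ^+ 2 * (1 + r * k%:R).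
  by rewrite ler_wpM2l// exprn_ge0// ltW.
lra.
Qed.

End Estimates.

(** * Termwise differentiation, Abel summation and absorption *)

Section Termwise.
Context {R : realType}.
Implicit Types (r x y z : R).

Lemma mean_value_near (f df : R -> R) x y : (forall z, is_derive z 1 f (df z)) ->
  exists2 c, `|c - x| <= `|y - x| & f y - f x = df c * (y - x).
Proof.
move=> dF; have [xy|yx|->] := ltgtP x y.
- have [c /andP[xc cy] E] := mean_value xy dF; exists c => //.
  by rewrite !gtr0_norm ?subr_gt0// lerD2r ltW.
- have [c /andP[xc cy] E] := mean_value yx dF; exists c; last first.
    by rewrite -opprB E -mulrN opprB.
  by rewrite !ltr0_norm ?subr_lt0// lerN2 lerD2r ltW.
- by exists y => //; rewrite !subrr mulr0.
Qed.

Lemma is_derive_quadratic (f : R -> R) x l M :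
  (forall y, `|f y - f x - l * (y - x)| <= M * (y - x) ^+ 2) ->
  is_derive x 1 f l.
Proof.
move=> H.
have M0 : 0 <= M by have := le_trans (normr_ge0 _) (H (x + 1)); rewrite addrAC subrr add0r expr1n mulr1.
have Q : (fun h => h^-1 *: ((f \o shift x) (h *: 1) - f x)) @ 0^' --> l.
  apply/cvgrPdist_le => e e0; near=> h.
  have h0 : h != 0 by near: h; exact: nbhs_dnbhs_neq.
  have := H (h + x); rewrite addrK => Hh.
  rewrite /= /GRing.scale/= mulr1 distrC.
  have -> : h^-1 * (f (h + x) - f x) - l = h^-1 * (f (h + x) - f x - l * h).
    by field.
  rewrite normrM normfV mulrC ler_pdivrMr ?normr_gt0//.
  apply: le_trans Hh _.
  have -> : M * h ^+ 2 = M * `|h| * `|h| by rewrite -mulrA -expr2 real_normK ?num_real.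
  rewrite ler_wpM2r//; apply: (@le_trans _ _ ((M + 1) * `|h|)).
    by rewrite ler_wpM2r// lerDl.
  rewrite mulrC -ler_pdivlMr ?ltr_wpDl//; near: h.
  by apply: dnbhs0_le; rewrite divr_gt0// ltr_wpDl.
by split; [exact: cvgP Q|exact: cvg_lim Q].
Unshelve. all: by end_near. Qed.

(** The Lipschitz bounds m k on the derivatives turn the mean value theorem into
a first-order Taylor estimate that is summable in k. *)
Lemma is_derive_series (F dF : nat -> R -> R) (m : nat -> R) x :
  (forall k y, is_derive y 1 (F k) (dF k y)) ->
  (forall k y, `|dF k y - dF k x| <= m k * `|y - x|) ->
  cvgn (series m) ->
  (forall y, cvgn (series (F ^~ y))) -> cvgn (series (dF ^~ x)) ->
  is_derive x 1 (fun y => limn (series (F ^~ y))) (limn (series (dF ^~ x))).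
Proof.
move=> dFF lip cm cF cdF; apply: (@is_derive_quadratic _ _ _ (limn (series m))) => y.
have c1 : (fun n => series (F ^~ y) n - series (F ^~ x) n -
   series (dF ^~ x) n * (y - x)) @ \oo --> limn (series (F ^~ y)) - limn (series (F ^~ x)) -
   limn (series (dF ^~ x)) * (y - x).
  by apply: cvgB; [apply: cvgB; exact: cF|apply: cvgM => //; exact: cvg_cst].
have c2 : (fun n => series m n * (y - x) ^+ 2) @ \oo --> limn (series m) * (y - x) ^+ 2.
  by apply: cvgM => //; exact: cvg_cst.
have /(_ _) c3 := cvg_norm c1.
rewrite -(cvg_lim _ c2)// -(cvg_lim _ c3)//.
apply: ler_lim; [exact: cvgP c3|exact: cvgP c2|apply: nearW => n].
rewrite /series/= -!sumrB !mulr_suml -sumrB.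
apply: le_trans (ler_norm_sum _ _ _) _; apply: ler_sum => k _.
have [c cx ->] := mean_value_near x y (dFF k).
rewrite -mulrBl normrM -[(y - x) ^+ 2]ger0_norm ?sqr_ge0// normrX expr2 mulrA.
rewrite ler_wpM2r//; apply: le_trans (lip k c) _.
rewrite ler_wpM2l//.
have := le_trans (normr_ge0 _) (lip k (x + 1)).
by rewrite addrAC subrr add0r normr1 mulr1.
Qed.

Lemma dominated_series (u m : nat -> R) : (forall k, `|u k| <= m k) ->
  cvgn (series m) -> cvgn (series u).
Proof.
move=> um cm; apply: normed_cvg.
by apply: (series_le_cvg _ _ um cm) => k //; exact: le_trans (um k).
Qed.

(** Two summations by parts move second differences onto a and leave the sums of
partial sums of m, which are multiples of Fejer means when m consists of Fourier modes. *)
Lemma abel_twice (a m : nat -> R) n :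
  let d n := \sum_(0 <= k < n) m k in
  let g n := \sum_(0 <= j < n) d j.+1 in
  \sum_(0 <= k < n) a k * m k = a n * d n + (a n - a n.+1) * g n +
    \sum_(0 <= k < n) (a k - 2 * a k.+1 + a k.+2) * g k.+1.
Proof.
move=> d g; elim: n => [|n IHn]; first by rewrite /g /d !big_geq// !mulr0 !addr0.
rewrite !big_nat_recr//= IHn.
have gS k : g k.+1 = g k + d k.+1 by rewrite /g big_nat_recr.
have dS k : d k.+1 = d k + m k by rewrite /d big_nat_recr.
rewrite !gS !dS; ring.
Qed.

Lemma cvg_series_inv_sqr r : 0 < r -> cvgn (series (fun k => (1 + r * k%:R) ^- 2)).
Proof.
move=> r0; apply: nondecreasing_is_cvgn.
  apply: nondecreasing_series => k _ _.
  by rewrite invr_ge0 exprn_ge0// addr_ge0// mulr_ge0// ltW.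
exists (1 + r^-1) => _ [n _ <-]; exact: sum_inv_sqr_le.
Qed.

(** Bounds for a derivative are obtained below from difference quotients, which
avoids differentiating under an integral that is singular in time. *)
Lemma normr_derive_le (p : R -> R) x l G d : 0 < d -> is_derive x 1 p l ->
  (forall y, `|y - x| < d -> `|p y - p x| <= G * `|y - x|) -> `|l| <= G.
Proof.
move=> d0 [dp <-] Hp.
have cv : (fun h => `|h^-1 *: (p (h *: 1 + x) - p x)|) @ 0^' --> `|'D_1 p x|.
  by apply: cvg_norm; exact: dp.
rewrite -(cvg_lim _ cv)//; apply: limr_le; first exact: cvgP cv.
near=> h.
have h0 : h != 0 by near: h; exact: nbhs_dnbhs_neq.
rewrite /GRing.scale/= mulr1 normrM normfV mulrC ler_pdivrMr ?normr_gt0//.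
have := Hp (h + x); rewrite addrK; apply.
by near: h; exact: dnbhs0_lt.
Unshelve. all: by end_near. Qed.

(** A bound that is finite a priori improves itself: applied to the least upper
bound s of E, the hypothesis gives s <= a + s / 2. *)
Lemma half_contraction (E : set R) a M : E !=set0 -> (forall v, E v -> v <= M) ->
  (forall m, m <= M -> (forall v, E v -> v <= m) -> forall v, E v -> v <= a + m / 2) ->
  forall v, E v -> v <= 2 * a.
Proof.
move=> E0 EM H v Ev.
have hE : has_sup E by split => //; exists M.
have sE w : E w -> w <= sup E by move=> Ew; exact: ub_le_sup hE.2 _ Ew.
have sM : sup E <= M by apply: ge_sup => // w; exact: EM.
have : sup E <= a + sup E / 2 by apply: ge_sup => // w Ew; exact: (H _ sM sE).
by have := sE _ Ev; lra.
Qed.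

End Termwise.

(** * Smoothing bounds for the biharmonic semigroup *)

Section Semigroup.
Context {R : realType}.
Implicit Types (f : R -> R) (r s x y z B : R).

Definition damp s k : R := expR (- (s * k%:R ^+ 4)).

Definition dfmode f k x : R :=
  (nfreq k)%:R * (k%:R * (fsin f k * cos (k%:R * x) - fcos f k * sin (k%:R * x))).

(** The first space derivative of the semigroup at s = nu t, as a series; the
second derivative [ddsemigroup] is defined likewise. *)
Definition dsemigroup s f x : R :=
  limn (series (fun k => damp s k * dfmode f k x)).

Definition ddsemigroup s f x : R :=
  limn (series (fun k => k%:R ^+ 2 * damp s k * - fmode f k x)).

Lemma damp_ge0 s k : 0 <= damp s k. Proof. exact: expR_ge0. Qed.

Lemma nfreq_le2 k : (nfreq k)%:R <= 2 :> R.
Proof. by case: k => [|k]; rewrite ?ler1n// ler_nat. Qed.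

Lemma is_derive_fmode f k x : is_derive x 1 (fmode f k) (dfmode f k x).
Proof. by rewrite /fmode /dfmode; apply: is_derive_eq; rewrite /GRing.scale/=; ring. Qed.

Lemma is_derive_dfmode f k x :
  is_derive x 1 (dfmode f k) (k%:R ^+ 2 * - fmode f k x).
Proof. by rewrite /fmode /dfmode; apply: is_derive_eq; rewrite /GRing.scale/=; ring. Qed.

Lemma normr_trig_le (a b c d B : R) : `|a| <= B -> `|b| <= B -> `|c| <= 1 -> `|d| <= 1 ->
  `|a * c + b * d| <= 2 * B.
Proof.
move=> aB bB c1 d1; rewrite mulr2n mulrDl mul1r.
by apply: le_trans (ler_normD _ _) _; rewrite !normrM lerD//;
  rewrite -[leRHS]mulr1 ler_pM.
Qed.

Lemma normr_fmode f B k x : continuous f -> (forall z, `|f z| <= B) ->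
  `|fmode f k x| <= 4 * B.
Proof.
move=> cf fB; rewrite /fmode normrM ger0_norm//.
have -> : 4 * B = 2 * (2 * B) by ring.
rewrite ler_pM ?nfreq_le2// normr_trig_le ?cos_max ?sin_max//.
  exact: normr_fcos.
exact: normr_fsin.
Qed.

Lemma normr_dfmode f B k x : continuous f -> (forall z, `|f z| <= B) ->
  `|dfmode f k x| <= 4 * B * k%:R.
Proof.
move=> cf fB; rewrite /dfmode normrM ger0_norm//.
have -> : 4 * B * k%:R = 2 * (k%:R * (2 * B)) by ring.
rewrite ler_pM ?nfreq_le2// normrM ger0_norm// ler_wpM2l// -mulNr.
rewrite normr_trig_le ?cos_max ?sin_max//; first exact: normr_fsin.
by rewrite normrN; exact: normr_fcos.
Qed.

Lemma damp_le r j k B : 0 < r -> (j <= 6)%N -> 0 <= B ->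
  k%:R ^+ j * damp (r ^+ 4) k * B <= 256 * B / r ^+ j * (1 + r * k%:R) ^- 2.
Proof.
move=> r0 j6 B0; have := ler_wpM2r B0 (nat_expR_le k r0 j6).
by move=> /le_trans; apply; rewrite le_eqVlt; apply/orP; left; apply/eqP; ring.
Qed.

Lemma cvg_series_dom r (a : R) : 0 < r ->
  cvgn (series (fun k => a * (1 + r * k%:R) ^- 2)).
Proof. by move=> r0; have := is_cvg_seriesZ (k := a) (cvg_series_inv_sqr r0). Qed.

Lemma lim_series_dom_le (u : nat -> R) r (a : R) : 0 < r -> 0 <= a ->
  (forall k, `|u k| <= a * (1 + r * k%:R) ^- 2) ->
  `|limn (series u)| <= a * (1 + r^-1).
Proof.
move=> r0 a0 ua.
have cu : cvgn (series u) := dominated_series ua (cvg_series_dom r0).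
have /(_ _) cn := cvg_norm cu.
rewrite -(cvg_lim _ cn)//; apply: limr_le; first exact: cvgP cn.
apply: nearW => n; rewrite /series/=; apply: le_trans (ler_norm_sum _ _ _) _.
apply: le_trans (ler_sum _ (fun k _ => ua k)) _.
by rewrite -mulr_sumr ler_wpM2l// sum_inv_sqr_le.
Qed.

Section fixed.
Variables (f : R -> R) (B r : R).
Hypotheses (cf : continuous f) (fB : forall z, `|f z| <= B) (r0 : 0 < r).

Let B0 : 0 <= B. Proof. exact: le_trans (fB 0). Qed.

Let term_le j k (u : R) : (j <= 6)%N -> `|u| <= 4 * B * k%:R ^+ j ->
  `|damp (r ^+ 4) k * u| <= 1024 * B / r ^+ j * (1 + r * k%:R) ^- 2.
Proof.
move=> j6 u4; rewrite normrM ger0_norm ?damp_ge0//.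
apply: le_trans (ler_wpM2l (damp_ge0 _ _) u4) _.
have := @damp_le r j k (4 * B) r0 j6; rewrite mulr_ge0// => /(_ isT) H.
apply: le_trans (le_trans _ H) _; rewrite le_eqVlt; apply/orP; left; apply/eqP; ring.
Qed.

Lemma semigroup_term_le k x :
  `|damp (r ^+ 4) k * fmode f k x| <= 1024 * B / r ^+ 0 * (1 + r * k%:R) ^- 2.
Proof. by apply: term_le => //; rewrite expr0 mulr1; exact: normr_fmode. Qed.

Lemma dsemigroup_term_le k x :
  `|damp (r ^+ 4) k * dfmode f k x| <= 1024 * B / r ^+ 1 * (1 + r * k%:R) ^- 2.
Proof. by apply: term_le => //; rewrite expr1; exact: normr_dfmode. Qed.

Lemma ddsemigroup_term_le k x :
  `|k%:R ^+ 2 * damp (r ^+ 4) k * - fmode f k x| <=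
  1024 * B / r ^+ 2 * (1 + r * k%:R) ^- 2.
Proof.
rewrite mulrAC mulrC; apply: term_le => //.
rewrite normrM normrN normrX ger0_norm// mulrC ler_wpM2r ?exprn_ge0//.
exact: normr_fmode.
Qed.

Lemma cvg_semigroup x :
  cvgn (series (fun k => damp (r ^+ 4) k * fmode f k x)).
Proof. exact: dominated_series (semigroup_term_le ^~ x) (cvg_series_dom r0). Qed.

Lemma cvg_dsemigroup x :
  cvgn (series (fun k => damp (r ^+ 4) k * dfmode f k x)).
Proof. exact: dominated_series (dsemigroup_term_le ^~ x) (cvg_series_dom r0). Qed.

Lemma cvg_ddsemigroup x :
  cvgn (series (fun k => k%:R ^+ 2 * damp (r ^+ 4) k * - fmode f k x)).
Proof. exact: dominated_series (ddsemigroup_term_le ^~ x) (cvg_series_dom r0). Qed.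

Lemma is_derive_semigroup x : is_derive x 1
  (fun y => limn (series (fun k => damp (r ^+ 4) k * fmode f k y)))
  (dsemigroup (r ^+ 4) f x).
Proof.
apply: (@is_derive_series _ (fun k y => damp (r ^+ 4) k * fmode f k y)
  (fun k y => damp (r ^+ 4) k * dfmode f k y)
  (fun k => 1024 * B / r ^+ 2 * (1 + r * k%:R) ^- 2)).
- by move=> k y; apply: is_deriveZ; exact: is_derive_fmode.
- move=> k y.
  have [c _ E] := mean_value_near x y (is_derive_dfmode f k).
  rewrite -mulrBr E mulrA normrM ler_wpM2r// mulrA [_ * k%:R ^+ 2]mulrC.
  exact: ddsemigroup_term_le.
- exact: cvg_series_dom.
- exact: cvg_semigroup.
- exact: cvg_dsemigroup.
Qed.

Lemma is_derive_dsemigroup x :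
  is_derive x 1 (dsemigroup (r ^+ 4) f) (ddsemigroup (r ^+ 4) f x).
Proof.
apply: (@is_derive_series _ (fun k y => damp (r ^+ 4) k * dfmode f k y)
  (fun k y => k%:R ^+ 2 * damp (r ^+ 4) k * - fmode f k y)
  (fun k => 1024 * B / r ^+ 3 * (1 + r * k%:R) ^- 2)).
- move=> k y; rewrite [_ * damp _ _]mulrC -mulrA.
  by apply: is_deriveZ; exact: is_derive_dfmode.
- move=> k y.
  have [c _ E] := mean_value_near x y (is_derive_fmode f k).
  have -> : k%:R ^+ 2 * damp (r ^+ 4) k * - fmode f k y -
      k%:R ^+ 2 * damp (r ^+ 4) k * - fmode f k x =
      - (damp (r ^+ 4) k * (k%:R ^+ 2 * dfmode f k c) * (y - x)).
    transitivity (- (damp (r ^+ 4) k * k%:R ^+ 2 * (fmode f k y - fmode f k x))).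
      by ring.
    by rewrite E; ring.
  rewrite normrN normrM ler_wpM2r//.
  apply: term_le => //; rewrite normrM ger0_norm ?exprn_ge0//.
  have -> : 4 * B * k%:R ^+ 3 = k%:R ^+ 2 * (4 * B * k%:R) by ring.
  by rewrite ler_wpM2l ?exprn_ge0//; exact: normr_dfmode.
- exact: cvg_series_dom.
- exact: cvg_dsemigroup.
- exact: cvg_ddsemigroup.
Qed.

(** Bounding the series termwise is enough here, because the first derivative
is allowed the same power of r as the second one. *)
Lemma normr_dsemigroup x : r <= 1 -> `|dsemigroup (r ^+ 4) f x| <= 2048 * B / r ^+ 2.
Proof.
move=> r1; have a0 : 0 <= 1024 * B / r ^+ 1 
  by apply: divr_ge0; [exact: (mulr_ge0 (ler0n _ _))|apply: exprn_ge0; exact: ltW].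
apply: le_trans (lim_series_dom_le r0 a0 (dsemigroup_term_le ^~ x)) _.
have ri : 1 <= r^-1 by rewrite invf_ge1.
have -> : 2048 * B / r ^+ 2 = 1024 * B / r ^+ 1 * (2 * r^-1) by field; rewrite gt_eqF.
by apply: ler_wpM2l => //; lra.
Qed.

(** The kernel of d_xx S has L^1 norm O(r^-2), with r^4 = nu t.  Termwise bounds
of the series would only give r^-3, that is t^(-3/4), which is too singular
for the cubic nonlinearity. *)
Lemma normr_ddsemigroup x : r <= 1 -> `|ddsemigroup (r ^+ 4) f x| <= 10000 * B / r ^+ 2.
Proof.
move=> r1.
have ri : 1 <= r^-1 by rewrite invf_ge1.
have /(_ _) cn := cvg_norm (@cvg_ddsemigroup x).
rewrite /ddsemigroup -(cvg_lim _ cn)//; apply: limr_le; first exact: cvgP cn.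
pose a k := k%:R ^+ 2 * damp (r ^+ 4) k : R.
pose w k := 256 / r ^+ 3 * (1 + r * k%:R) ^- 2.
have w0 : w @ \oo --> 0 by apply: cvg_series_cvg_0; exact: cvg_series_dom.
near=> n.
have -> : series (fun k => k%:R ^+ 2 * damp (r ^+ 4) k * - fmode f k x) n =
    - \sum_(0 <= k < n) a k * fmode f k x.
  by rewrite /series/= -sumrN; apply: eq_bigr => k _; rewrite mulrN.
pose d k := \sum_(0 <= i < k) fmode f i x.
pose g k := \sum_(0 <= j < k) d j.+1.
rewrite normrN (abel_twice a (fun k => fmode f k x) n) -/(d n) -/(g n).
have dn k : `|d k| <= 4 * B * k%:R.
  apply: le_trans (ler_norm_sum _ _ _) _.
  apply: le_trans (ler_sum _ (fun k _ => @normr_fmode f B k x cf fB)) _.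
  by rewrite sumr_const_nat subn0 mulr_natr.
have gn k : `|g k| <= B * k%:R by rewrite mulrC; exact: normr_fejer_mean.
have a0 k : 0 <= a k by rewrite mulr_ge0 ?exprn_ge0// damp_ge0.
have an k : a k * k%:R <= 256 / r ^+ 3 * (1 + r * k%:R) ^- 2.
  have := @nat_expR_le _ r 3 k r0 isT.
  by apply: le_trans; rewrite exprSr /a /damp mulrAC.
have anS : a n.+1 * n%:R <= w n.
  apply: (@le_trans _ _ (a n.+1 * n.+1%:R)); first by rewrite ler_wpM2l// ler_nat.
  have w0' : 0 <= 256 / r ^+ 3 by exact: (divr_ge0 (ler0n _ _) (exprn_ge0 _ (ltW r0))).
  apply: le_trans (an _) _; apply: (ler_wpM2l w0').
  rewrite lef_pV2 ?posrE ?exprn_gt0 ?ltr_wpDr ?mulr_ge0 ?(ltW r0)//.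
  rewrite lerXn2r ?nnegrE ?addr_ge0 ?mulr_ge0 ?(ltW r0)//.
  by rewrite lerD2l ler_wpM2l ?(ltW r0)// ler_nat.
have S : `|\sum_(0 <= k < n) (a k - 2 * a k.+1 + a k.+2) * g k.+1| <=
    B * (4096 / r * (1 + r^-1)).
  apply: le_trans (ler_norm_sum _ _ _) _.
  apply: (@le_trans _ _ (\sum_(0 <= k < n) B * (4096 / r * (1 + r * k%:R) ^- 2))).
    apply: ler_sum => k _; rewrite normrM.
    apply: le_trans (ler_wpM2l _ (gn k.+1)) _ => //.
    rewrite mulrCA ler_wpM2l// mulrC; exact: second_difference.
  rewrite -!mulr_sumr; apply: (ler_wpM2l B0).
  have c0 : 0 <= 4096 / r by exact: (divr_ge0 (ler0n _ _) (ltW r0)).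
  by apply: (ler_wpM2l c0); exact: sum_inv_sqr_le.
(* The boundary terms of the two summations vanish as n grows. *)
have wn : 6 * w n <= r^-1 ^+ 2.
  rewrite mulrC -ler_pdivlMr//; near: n.
  by apply: (cvgr_le 0 w0); rewrite divr_gt0// exprn_gt0// invr_gt0.
have T1 : `|a n * d n| <= 4 * B * w n.
  rewrite normrM ger0_norm//; apply: le_trans (ler_wpM2l _ (dn n)) _ => //.
  by rewrite mulrCA ler_wpM2l ?mulr_ge0//; exact: an.
have T2 : `|(a n - a n.+1) * g n| <= 2 * B * w n.
  rewrite normrM; apply: le_trans (ler_pM _ _ (ler_normB _ _) (gn n)) _ => //.
  rewrite !ger0_norm// mulrCA [2 * B]mulrC -mulrA ler_wpM2l//.
  by rewrite mulrDl mulrDl mul1r lerD//; exact: an.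
have -> : 10000 * B / r ^+ 2 = B * (10000 * r^-1 ^+ 2) by rewrite -exprVn; ring.
apply: le_trans (ler_normD _ _) _; apply: le_trans (lerD (ler_normD _ _) S) _.
apply: le_trans (lerD (lerD T1 T2) (lexx _)) _.
have -> : 4 * B * w n + 2 * B * w n + B * (4096 / r * (1 + r^-1)) =
  B * (6 * w n + 4096 / r * (1 + r^-1)) by ring.
rewrite ler_wpM2l//.
have : r^-1 <= r^-1 ^+ 2 by rewrite expr2; nra.
nra.
Unshelve. all: by end_near. Qed.

End fixed.
End Semigroup.

(** * Trigonometric polynomials under the semigroup *)

Section TrigData.
Context {R : realType}.
Implicit Types (f g : R -> R) (r s x y z lam p : R).

Lemma circle_int_cos_phase (m : nat) p :
  circle_int (fun z => cos (m%:R * z + p)) = if m == 0%N then cos p * (pi *+ 2) else 0.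
Proof.
case: ifPn => [/eqP->|m0].
  by under eq_fun do rewrite mul0r add0r; rewrite circle_int_cst.
rewrite -(@circle_int_cos _ m (- (p / m%:R))) ?lt0n//.
congr circle_int; apply/funext => z; rewrite -cosN; congr cos.
by field; rewrite pnatr_eq0.
Qed.

Lemma continuous_cos_phase (m : nat) p : continuous (fun z : R => cos (m%:R * z + p)).
Proof.
move=> z; apply: continuous_comp; last exact: continuous_cos.
by apply: cvgD; [exact: mulrl_continuous|exact: cvg_cst].
Qed.

(** The phase p covers both the cosine (p = 0) and the sine (p = - pi / 2). *)
Lemma fmode_cos (j : nat) p k x :
  fmode (fun z => cos (j%:R * z + p)) k x = if k == j then cos (k%:R * x + p) else 0.
Proof.
rewrite fmodeE; last exact: continuous_cos_phase.
have -> : (fun z => cos (j%:R * z + p) * ((nfreq k)%:R * cos (k%:R * (x - z)))) =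
  (fun z => (nfreq k)%:R / 2 * cos ((j + k)%N%:R * z + (p - k%:R * x)) +
     (nfreq k)%:R / 2 * cos ((maxn j k - minn j k)%N%:R * z +
        (if (j <= k)%N then - (p + k%:R * x) else p + k%:R * x))).
  apply/funext => z; rewrite -mulrDr.
  have -> : cos ((maxn j k - minn j k)%N%:R * z +
        (if (j <= k)%N then - (p + k%:R * x) else p + k%:R * x)) =
      cos ((j%:R * z + p) + k%:R * (x - z)).
    case: leqP => jk.
      by rewrite natrB// -cosN; congr cos; ring.
    by rewrite natrB ?(ltnW jk)//; congr cos; ring.
  have -> : (j + k)%:R * z + (p - k%:R * x) = (j%:R * z + p) - k%:R * (x - z).
    by rewrite natrD; ring.
  move: (j%:R * z + p) (k%:R * (x - z)) => A e; by rewrite (cosD A e) (cosB A e); field.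
have cst (a : R) (m : nat) q : continuous (fun z : R => a * cos (m%:R * z + q)).
  by apply: continuous_mulr; [move=> z; exact: cvg_cst|exact: continuous_cos_phase].
rewrite circle_intD// !circle_intZ; [|exact: continuous_cos_phase..].
rewrite !circle_int_cos_phase addn_eq0.
have pi2 : (pi : R) *+ 2 != 0 by rewrite gt_eqF// pmulrn_lgt0// pi_gt0.
move: ((pi : R) *+ 2) pi2 => q q0.
have [->|kj] := eqVneq k j.
  rewrite leqnn maxnn minnn subnn eqxx cosN (addrC p (_ * x)).
  by case: j => [|j] /=; rewrite ?mul0r ?subr0 ?add0r; field.
rewrite (_ : (maxn j k - minn j k)%N == 0%N = false); last first.
  apply/negbTE; rewrite subn_eq0 -ltnNge.
  by case: (ltngtP j k) kj => // ->; rewrite eqxx.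
rewrite (_ : (j == 0%N) && (k == 0%N) = false) ?mulr0 ?addr0 ?mulr0//.
by apply/negbTE; apply: contra kj => /andP[/eqP-> /eqP->].
Qed.

Lemma fmodeD f g k x : continuous f -> continuous g ->
  fmode (fun z => f z + g z) k x = fmode f k x + fmode g k x.
Proof.
move=> cf cg.
have cD : continuous (fun z => f z + g z) by move=> z; apply: cvgD; [exact: cf|exact: cg].
have cc (h : R -> R) : continuous h ->
    continuous (fun z => h z * ((nfreq k)%:R * cos (k%:R * (x - z)))).
  move=> ch; apply: continuous_mulr => //; apply: continuous_mulr.
    by move=> z; exact: cvg_cst.
  exact: continuous_cos_affine.
rewrite !fmodeE// -mulrDr -circle_intD; [|exact: cc..].
by congr (_ * circle_int _); apply/funext => z; rewrite mulrDl.
Qed.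

Lemma fmodeZ a f k x : continuous f ->
  fmode (fun z => a * f z) k x = a * fmode f k x.
Proof.
move=> cf.
have cZ : continuous (fun z => a * f z).
  by apply: continuous_mulr => // z; exact: cvg_cst.
have cc : continuous (fun z => f z * ((nfreq k)%:R * cos (k%:R * (x - z)))).
  apply: continuous_mulr => //; apply: continuous_mulr.
    by move=> z; exact: cvg_cst.
  exact: continuous_cos_affine.
rewrite !fmodeE// [RHS]mulrCA; congr (_ * _); rewrite -circle_intZ//.
by congr circle_int; apply/funext => z; rewrite -mulrA.
Qed.

Definition trig (a : nat -> R) p N x := \sum_(0 <= j < N) a j * cos (j%:R * x + p).

Lemma continuous_trig a p N : continuous (trig a p N).
Proof.
apply: continuous_big_sum => k.
by apply: continuous_mulr; [move=> z; exact: cvg_cst|exact: continuous_cos_phase].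
Qed.

Lemma fmode_trig a p N k x :
  fmode (trig a p N) k x = if (k < N)%N then a k * cos (k%:R * x + p) else 0.
Proof.
elim: N => [|N IHN].
  rewrite (_ : trig a p 0 = fun z => 0 * cos (0%:R * z + 0)).
    by rewrite fmodeZ ?mul0r//; exact: continuous_cos_phase.
  by apply/funext => z; rewrite /trig big_geq// mul0r.
rewrite (_ : trig a p N.+1 = fun z => trig a p N z + a N * cos (N%:R * z + p)).
  rewrite fmodeD ?IHN; last 2 first.
  - exact: continuous_trig.
  - by apply: continuous_mulr; [move=> z; exact: cvg_cst|exact: continuous_cos_phase].
  rewrite fmodeZ; last exact: continuous_cos_phase.
  rewrite fmode_cos [in RHS]ltnS [in RHS]leq_eqVlt.
  have [->|kN] /= := eqVneq k N; first by rewrite ltnn add0r.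
  by rewrite mulr0 addr0.
by apply/funext => z; rewrite /trig big_nat_recr.
Qed.

Lemma lim_series_trig (w a : nat -> R) p N x :
  limn (series (fun k => w k * fmode (trig a p N) k x)) =
  \sum_(0 <= k < N) w k * (a k * cos (k%:R * x + p)).
Proof.
apply: lim_near_cst => //; near=> n.
rewrite /series/=.
have Nn : (N <= n)%N by near: n; exact: nbhs_infty_ge.
rewrite (big_cat_nat (leq0n N) Nn)//= [X in _ + X]big1_seq ?addr0.
  by apply: eq_big_nat => k /andP[_ kN]; rewrite fmode_trig kN.
move=> k; rewrite mem_index_iota => /andP[_ /andP[Nk _]].
by rewrite fmode_trig ltnNge Nk mulr0.
Unshelve. all: by end_near. Qed.

Lemma ddsemigroup_trig s a N y :
  ddsemigroup s (trig a 0 N) y =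
  - \sum_(0 <= k < N) k%:R ^+ 2 * a k * (damp s k * cos (k%:R * y)).
Proof.
rewrite /ddsemigroup.
have -> : (fun k => k%:R ^+ 2 * damp s k * - fmode (trig a 0 N) k y) =
    (fun k => - (k%:R ^+ 2 * damp s k) * fmode (trig a 0 N) k y).
  by apply/funext => k; rewrite mulrN mulNr.
rewrite lim_series_trig -sumrN; apply: eq_bigr => k _; rewrite addr0; ring.
Qed.

Lemma damp_le1 s k : 0 <= s -> damp s k <= 1.
Proof. by move=> s0; rewrite /damp -expR0 ler_expR oppr_le0 mulr_ge0// exprn_ge0. Qed.

Lemma damp_ge s k : 1 - s * k%:R ^+ 4 <= damp s k.
Proof. exact: expR_ge1Dx. Qed.

Lemma normr_ddsemigroup_trig s a y : 0 <= s -> (forall k, `|a k| <= 2) ->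
  `|ddsemigroup s (trig a 0 10) y| <= 1620.
Proof.
move=> s0 a2; rewrite ddsemigroup_trig normrN; apply: le_trans (ler_norm_sum _ _ _) _.
apply: (@le_trans _ _ (\sum_(0 <= k < 10) 162)); last first.
  by rewrite sumr_const_nat subn0 -mulr_natr; lra.
rewrite !big_nat; apply: ler_sum => k /andP[_ k10].
rewrite normrM -[leRHS]mulr1 ler_pM//.
  rewrite normrM ger0_norm ?exprn_ge0//.
  have k81 : k%:R ^+ 2 <= 81 :> R by rewrite -natrX ler_nat (@leq_exp2r _ 9 2).
  have -> : 162 = 81 * 2 :> R by ring.
  exact: (ler_pM (exprn_ge0 _ (ler0n _ _)) (normr_ge0 _) k81 (a2 k)).
rewrite normrM ger0_norm ?damp_ge0//.
by rewrite -[leRHS]mulr1 ler_pM ?damp_ge0 ?damp_le1 ?cos_max.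
Qed.

Lemma cos_lipschitz0 x : `|1 - cos x| <= `|x|.
Proof.
have [c _ E] := mean_value_near 0 x (@is_derive_cos R).
rewrite distrC -{1}cos0 E subr0 normrM -[leRHS]mul1r ler_wpM2r//.
by rewrite normrN sin_max.
Qed.

(** The moment condition says that the second derivative of the trigonometric
polynomial vanishes at 0, so only the variation of damp s k * cos (k y)
away from 1 counts. *)
Lemma ddsemigroup_trig_near0 s a y : 0 <= s -> (forall k, `|a k| <= 2) ->
  \sum_(0 <= k < 10) k%:R ^+ 2 * a k = 0 ->
  `|ddsemigroup s (trig a 0 10) y| <= 10 * (162 * 6561) * (s + `|y|).
Proof.
move=> s0 a2 a0.
have -> : ddsemigroup s (trig a 0 10) y =
    \sum_(0 <= k < 10) k%:R ^+ 2 * a k * (1 - damp s k * cos (k%:R * y)).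
  rewrite ddsemigroup_trig; transitivity (\sum_(0 <= k < 10) k%:R ^+ 2 * a k -
      \sum_(0 <= k < 10) k%:R ^+ 2 * a k * (damp s k * cos (k%:R * y))).
    by rewrite a0 sub0r.
  by rewrite -sumrB; apply: eq_bigr => k _; ring.
apply: le_trans (ler_norm_sum _ _ _) _.
apply: (@le_trans _ _ (\sum_(0 <= k < 10) 162 * (6561 * (s + `|y|)))); last first.
  by rewrite sumr_const_nat subn0 -mulr_natr; lra.
rewrite !big_nat; apply: ler_sum => k /andP[_ k10].
rewrite normrM ler_pM//.
  rewrite normrM ger0_norm ?exprn_ge0//.
  have k81 : k%:R ^+ 2 <= 81 :> R by rewrite -natrX ler_nat (@leq_exp2r _ 9 2).
  have -> : 162 = 81 * 2 :> R by ring.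
  exact: (ler_pM (exprn_ge0 _ (ler0n _ _)) (normr_ge0 _) k81 (a2 k)).
have -> : 1 - damp s k * cos (k%:R * y) =
  (1 - damp s k) + damp s k * (1 - cos (k%:R * y)) by ring.
apply: le_trans (ler_normD _ _) _; rewrite [leRHS]mulrDr lerD//.
  rewrite ger0_norm ?subr_ge0 ?damp_le1//.
  have k4 : k%:R ^+ 4 <= 6561 :> R by rewrite -natrX ler_nat (@leq_exp2r _ 9 4).
  have := damp_ge s k; nra.
rewrite normrM ger0_norm ?damp_ge0//.
apply: (@le_trans _ _ (1 * `|k%:R * y|)).
  by rewrite ler_pM ?damp_ge0 ?damp_le1 ?cos_lipschitz0.
rewrite mul1r normrM ger0_norm// ler_wpM2r// ler_nat.
by rewrite (leq_trans (ltnW k10)).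
Qed.

End TrigData.

(** * The initial height and its linear evolution *)

Section Data.
Context {R : realType}.
Implicit Types (f g : R -> R) (r s t x y z lam nu : R).

(** Its slope is lam (3c - c^3) / 2 with c = cos x: it is the combination
of cos x and cos (3x) that has value lam and second derivative 0 at x = 0. *)
Definition height0 lam x : R := lam * (9 / 8 * sin x - 1 / 24 * sin (3 * x)).
Definition slope0 lam x : R := lam * (9 / 8 * cos x - 1 / 8 * cos (3 * x)).

Lemma is_derive_height0 lam x : is_derive x 1 (height0 lam) (slope0 lam x).
Proof. by rewrite /height0 /slope0; apply: is_derive_eq; rewrite /GRing.scale/=; field. Qed.

Lemma derive1_height0 lam : derive1 (height0 lam) = slope0 lam.
Proof.
by apply/funext => x; rewrite derive1E; apply: derive_val; exact: is_derive_height0.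
Qed.

Lemma cos_rec k x : cos (k.+2%:R * x) = 2 * cos x * cos (k.+1%:R * x) - cos (k%:R * x).
Proof.
have -> : k.+2%:R * x = k.+1%:R * x + x by rewrite -[in LHS]natr1; ring.
have -> : k%:R * x = k.+1%:R * x - x by rewrite -natr1; ring.
rewrite cosD cosB; ring.
Qed.

Lemma cos3E x : cos (3 * x) = 4 * cos x ^+ 3 - 3 * cos x.
Proof. by rewrite !cos_rec mul0r cos0 mul1r; ring. Qed.

(** 1 -+ (3c - c^3) / 2 = (1 -+ c)^2 (2 +- c) / 2, which is
nonnegative for |c| <= 1. *)
Lemma normr_slope0 lam x : 0 <= lam -> `|slope0 lam x| <= lam.
Proof.
move=> l0; rewrite /slope0 normrM ger0_norm// -[leRHS]mulr1 ler_wpM2l// cos3E.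
have := cos_le1 x; have := cos_geN1 x; move: (cos x) => c c1 c2.
have -> : 9 / 8 * c - 1 / 8 * (4 * c ^+ 3 - 3 * c) = (3 * c - c ^+ 3) / 2 by field.
have h1 : 0 <= (1 - c) ^+ 2 * (2 + c) by rewrite mulr_ge0 ?sqr_ge0//; lra.
have h2 : 0 <= (1 + c) ^+ 2 * (2 - c) by rewrite mulr_ge0 ?sqr_ge0//; lra.
by rewrite ler_norml; apply/andP; split; lra.
Qed.

Lemma circle_fun_height0 lam : circle_fun (height0 lam).
Proof.
move=> x; rewrite /height0 sinD2pi.
have -> : 3 * (x + pi *+ 2) = 3 * x + (pi *+ 2) *+ 3 :> R by ring.
by rewrite (periodicn (@sinD2pi R)).
Qed.

Lemma smooth_height0 lam : smooth (height0 lam).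
Proof.
pose g a b c d x : R := a * sin x + b * cos x + c * sin (3 * x) + d * cos (3 * x).
have dg a b c d x : is_derive x 1 (g a b c d) (g (- b) a (- 3 * d) (3 * c) x).
  by rewrite /g; apply: is_derive_eq; rewrite /GRing.scale/=; ring.
have H n : exists a b c d, derive1n n (height0 lam) = g a b c d.
  elim: n => [|n [a [b [c [d IHn]]]]].
    exists (lam * (9 / 8)), 0, (- (lam / 24)), 0.
    by apply/funext => x; rewrite /= /g /height0; field.
  exists (- b), a, (- 3 * d), (3 * c).
  rewrite derive1nS IHn; apply/funext => x; rewrite derive1E.
  by apply: derive_val.
by move=> n x; have [a [b [c [d ->]]]] := H n; have [] := dg a b c d x.
Qed.

Definition height0_coef lam (k : nat) : R := lam * nth 0 [:: 0; 9 / 8; 0; - (1 / 24)] k.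

Lemma height0_trig lam : height0 lam = trig (height0_coef lam) (- (pi / 2)) 4.
Proof.
apply/funext => x; rewrite /trig !big_nat_recr//= big_geq// /height0_coef/=.
by rewrite !cosBpihalf (mul1r x) /height0; field.
Qed.

Lemma circle_int_height0 lam : circle_int (height0 lam) = 0.
Proof.
have := fmode_trig (height0_coef lam) (- (pi / 2)) 4 0 0.
rewrite -height0_trig /height0_coef/= mulr0 mul0r /fmode/= !mul0r sin0 cos0 mulr0 addr0 mulr1 mul1r.
rewrite /fcos.
have -> : (fun x => height0 lam x * cos (0%:R * x)) = height0 lam.
  by apply/funext => x; rewrite mul0r cos0 mulr1.
have pi2 : (pi : R) *+ 2 != 0 by rewrite gt_eqF// pmulrn_lgt0// pi_gt0.
by move/eqP; rewrite mulf_eq0 invr_eq0 (negbTE pi2) => /eqP.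
Qed.

Lemma semigroup_height0 nu t lam x : biharmonic_semigroup nu t (height0 lam) x =
  lam * (9 / 8 * expR (- (nu * t)) * sin x - 1 / 24 * expR (- (81 * (nu * t))) * sin (3 * x)).
Proof.
rewrite /biharmonic_semigroup height0_trig.
rewrite (lim_series_trig (fun k => expR (- (nu * t * k%:R ^+ 4)))).
rewrite !big_nat_recr//= big_geq// /height0_coef/= !cosBpihalf (mul1r x).
rewrite expr1n mulr1 (_ : 3 ^+ 4 = 81); last by ring.
by rewrite [81 * _]mulrC; ring.
Qed.

(** The slope of the solution of the linear equation h_t = - nu h_xxxx. *)
Definition slope_lin nu t lam x : R :=
  lam * (9 / 8 * expR (- (nu * t)) * cos x - 1 / 8 * expR (- (81 * (nu * t))) * cos (3 * x)).

Lemma is_derive_semigroup_height0 nu t lam x :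
  is_derive x 1 (biharmonic_semigroup nu t (height0 lam)) (slope_lin nu t lam x).
Proof.
rewrite (_ : biharmonic_semigroup nu t _ = fun x =>
  lam * (9 / 8 * expR (- (nu * t)) * sin x - 1 / 24 * expR (- (81 * (nu * t))) * sin (3 * x))).
  by rewrite /slope_lin; apply: is_derive_eq; rewrite /GRing.scale/=; field.
by apply/funext => y; exact: semigroup_height0.
Qed.

Lemma normr_slope_lin nu t lam x : 0 <= nu * t -> 0 <= lam <= 1 ->
  `|slope_lin nu t lam x| <= 5 / 4.
Proof.
move=> nt /andP[l0 l1]; rewrite /slope_lin normrM ger0_norm//.
have e1 : expR (- (nu * t)) <= 1 by rewrite -expR0 ler_expR oppr_le0.
have e2 : expR (- (81 * (nu * t))) <= 1.
  by rewrite -expR0 ler_expR oppr_le0; apply: mulr_ge0 => //; exact: ler0n.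
apply: (@le_trans _ _ (1 * (9 / 8 + 1 / 8))); last by lra.
apply: ler_pM => //; apply: le_trans (ler_normB _ _) _; apply: lerD.
  rewrite normrM -[leRHS]mulr1 ler_pM ?cos_max//.
  by rewrite ger0_norm ?mulr_ge0 ?expR_ge0//; have := expR_ge0 (- (nu * t)); lra.
rewrite normrM -[leRHS]mulr1 ler_pM ?cos_max//.
rewrite ger0_norm; last by apply: mulr_ge0; [lra|exact: expR_ge0].
by have := expR_ge0 (- (81 * (nu * t))); lra.
Qed.

Lemma slope_lin_slope0 nu t lam x : 0 <= nu * t -> 0 <= lam <= 1 ->
  `|slope_lin nu t lam x - slope0 lam x| <= 12 * (nu * t).
Proof.
move=> nt /andP[l0 l1].
have -> : slope_lin nu t lam x - slope0 lam x =
   lam * (9 / 8 * ((expR (- (nu * t)) - 1) * cos x) -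
          1 / 8 * ((expR (- (81 * (nu * t))) - 1) * cos (3 * x))).
  by rewrite /slope_lin /slope0; ring.
have E a y : 0 <= a -> `|(expR (- a) - 1) * cos y| <= a.
  move=> a0; rewrite normrM -[leRHS]mulr1 ler_pM ?cos_max//.
  have h1 : expR (- a) <= 1 by rewrite -expR0 ler_expR oppr_le0.
  have h2 : 1 + - a <= expR (- a) := expR_ge1Dx (- a).
  by rewrite ler_norml; apply/andP; split; lra.
have E1 := E _ x nt.
have E2 : `|(expR (- (81 * (nu * t))) - 1) * cos (3 * x)| <= 81 * (nu * t).
  by apply: E; apply: mulr_ge0 => //; exact: ler0n.
rewrite normrM ger0_norm//.
apply: (@le_trans _ _ (1 * (9 / 8 * (nu * t) + 1 / 8 * (81 * (nu * t))))); last by lra.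
apply: ler_pM => //; apply: le_trans (ler_normB _ _) _.
have n1 : 0 <= 9 / 8 :> R by lra.
have n2 : 0 <= 1 / 8 :> R by lra.
apply: lerD; rewrite normrM ger0_norm//; exact: ler_wpM2l.
Qed.

(** The growth rate 9 nu is (81 - 9) / 8 times nu: the negative mode cos (3x)
decays 81 times faster than cos x.  This is where the maximum principle
fails. *)
Lemma slope_lin0_ge nu t lam : 0 <= nu * t -> 0 <= lam ->
  lam * (1 + 9 * (nu * t) - 821 * (nu * t) ^+ 2) <= slope_lin nu t lam 0.
Proof.
move=> nt l0; rewrite /slope_lin mulr0 cos0 !mulr1 ler_wpM2l//.
move: (nu * t) nt => w w0.
have h1 : 1 + - w <= expR (- w) := expR_ge1Dx (- w).
suff : expR (- (81 * w)) <= 1 - 81 * w + (81 * w) ^+ 2 by nra.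
have z0 : 0 <= 81 * w by apply: mulr_ge0 => //; exact: ler0n.
move: (81 * w) z0 => z z0.
rewrite expRN -div1r ler_pdivrMr ?expR_gt0//.
have h2 : 1 + z <= expR z := expR_ge1Dx z.
have h3 : 0 <= z ^+ 2 by exact: sqr_ge0.
have h4 : 0 <= 1 - z + z ^+ 2 by nra.
apply: le_trans (ler_wpM2l h4 h2).
have -> : (1 - z + z ^+ 2) * (1 + z) = 1 + z ^+ 3 by ring.
by rewrite lerDl exprn_ge0.
Qed.

(** The Fourier coefficients of u^3 - u for the initial slope u. *)
Definition flux0_coef lam (k : nat) : R :=
  lam ^+ 3 * (nth 0 [:: 0; 1998; 0; 240; 0; - 216; 0; 27; 0; - 1] k / 2048) -
  lam * (nth 0 [:: 0; 9; 0; - 1] k / 8).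

Lemma flux0_trig lam : (fun x => slope0 lam x ^+ 3 - slope0 lam x) =
  trig (flux0_coef lam) 0 10.
Proof.
apply/funext => x; rewrite /trig !big_nat_recr//= big_geq// /flux0_coef/=.
rewrite !addr0 /slope0 !cos_rec (mul0r x) cos0 (mul1r x).
by move: (cos x) => c; field.
Qed.

(** (u^3 - u)_xx = (3 u^2 - 1) u_xx + 6 u u_x^2 vanishes where both u_x and u_xx
do. *)
Lemma flux0_coef_moment lam : \sum_(0 <= k < 10) k%:R ^+ 2 * flux0_coef lam k = 0.
Proof. by rewrite !big_nat_recr//= big_geq// /flux0_coef/=; field. Qed.

Lemma normr_flux0_coef lam k : 0 <= lam <= 1 -> `|flux0_coef lam k| <= 2.
Proof.
move=> /andP[l0 l1]; rewrite /flux0_coef.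
have l3 : 0 <= lam ^+ 3 by rewrite exprn_ge0.
have l31 : lam ^+ 3 <= 1 by rewrite exprn_ile1.
case: k => [|[|[|[|[|[|[|[|[|[|k]]]]]]]]]] /=; rewrite ?nth_nil; rewrite ler_norml; apply/andP; split; lra.
Qed.

End Data.

(** * The essential supremum of a continuous function *)

Section Linf.
Context {R : realType}.
Implicit Types (f g : R -> R) (x y M : R).
Local Notation mu := (@lebesgue_measure R).

Lemma lebesgue_measure_setT_gt0 : (0 < mu [set: R])%E.
Proof.
apply: (@lt_le_trans _ _ (mu `]0, 1[%classic)).
  by rewrite lebesgue_measure_itv/= lte_fin ltr01 EFinN oppe0 adde0 lte_fin.
by apply: le_measure; rewrite ?inE.
Qed.

Lemma Linf_normE f : Linf_norm f = ess_sup mu (fun x => `|f x|%:E).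
Proof.
rewrite /Linf_norm unlock /Lnorm lebesgue_measure_setT_gt0.
by congr ess_sup; apply/funext => x.
Qed.

Lemma Linf_norm_le f M : (forall x, `|f x| <= M) -> (Linf_norm f <= M%:E)%E.
Proof. by move=> fM; rewrite Linf_normE; apply/ess_supP/nearW => x; rewrite lee_fin. Qed.

(** If |f x| exceeded the essential supremum, so would |f| on an interval around
x, which has positive measure. *)
Lemma le_Linf_norm f x : continuous f -> (`|f x|%:E <= Linf_norm f)%E.
Proof.
move=> cf; rewrite leNgt Linf_normE; apply/negP => Hlt.
have : exists2 m : R, (ess_sup mu (fun x => `|f x|%:E) <= m%:E)%E & m < `|f x|.
  move: Hlt; case: (ess_sup _ _) => [r| |].
  - by rewrite lte_fin => rf; exists r.
  - by rewrite ltNge leey.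
  - by move=> _; exists (`|f x| - 1); [exact: leNye|rewrite ltrBlDr ltrDl].
move=> [m Em mf].
have [N [mN N0 HN]] := ess_supP Em.
have cn : `|f y| @[y --> x] --> `|f x| by apply: cvg_norm; exact: cf.
have /nbhs_ballP[e /= e0 He] : \forall y \near x, m < `|f y| by exact: (cvgr_gt _ cn).
have sub : `]x - e, x + e[%classic `<=` N.
  move=> y /=; rewrite in_itv/= => yx; apply: HN => /=; rewrite lee_fin => fy.
  have : m < `|f y| by apply: He; rewrite /ball/= ltr_distlC.
  by rewrite ltNge fy.
have : mu `]x - e, x + e[%classic = 0%E.
  apply/(@measure_negligible _ _ _ mu); last by exists N.
  exact: measurable_itv.
rewrite lebesgue_measure_itv/= lte_fin ifT; last by rewrite ltrBlDr -addrA ltrDl addr_gt0.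
rewrite -EFinB => -[] /eqP; rewrite (_ : x + e - (x - e) = e + e); last by ring.
by rewrite gt_eqF// addr_gt0.
Qed.

Lemma Linf_norm_gt f x M : continuous f -> M < `|f x| -> (M%:E < Linf_norm f)%E.
Proof. by move=> cf Mf; apply: lt_le_trans (le_Linf_norm x cf); rewrite lte_fin. Qed.

End Linf.

(** * Singular integrals in time *)

Section Improper.
Context {R : realType}.
Implicit Types (f g G : R -> R) (a b s t x y M : R).
Local Notation mu := (@lebesgue_measure R).

Lemma measurable_fun_oo g a b : (forall x, a < x < b -> {for x, continuous g}) ->
  measurable_fun `]a, b[ g.
Proof.
move=> cg; apply: open_continuous_measurable_fun; first exact: interval_open.
by move=> x; rewrite inE/= in_itv/=; exact: cg.
Qed.

(** The function g may blow up at both ends of the interval: the fundamental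
theorem applies on an increasing sequence of segments, and monotone
convergence gives the bound in the limit. *)
Lemma improper_FTC2_le g G a b M : a < b ->
  (forall x, a < x < b -> 0 <= g x) ->
  (forall x, a < x < b -> is_derive x 1 G (g x)) ->
  (forall x, a < x < b -> {for x, continuous g}) ->
  (forall x y, a < x < b -> a < y < b -> G y - G x <= M) ->
  (\int[mu]_(x in `]a, b[) (g x)%:E <= M%:E)%E.
Proof.
move=> ab g0 dG cg GM.
pose d n : R := (b - a) / 2 / n.+2%:R.
have ba : 0 < b - a by rewrite subr_gt0.
have d0 n : 0 < d n by rewrite !divr_gt0.
have d1 n : d n < (b - a) / 2.
  by rewrite ltr_pdivrMr// ltr_pMr ?divr_gt0// ltr1n.
pose F n : set R := `[a + d n, b - d n]%classic.
have Fin n x : F n x -> a < x < b.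
  rewrite /F/= in_itv/= => /andP[h1 h2].
  by rewrite (lt_le_trans _ h1) ?ltrDl// (le_lt_trans h2)// ltrBlDr ltrDl.
have FU : `]a, b[%classic = \bigcup_n F n.
  apply/seteqP; split => [x|x [n _]]; last by move=> /Fin; rewrite /= in_itv.
  rewrite /= in_itv/= => /andP[ax xb].
  (* A point belongs to F n as soon as d n is below its distance to the ends. *)
pose e := Num.min (x - a) (b - x).
  have e0 : 0 < e by rewrite lt_min !subr_gt0 ax xb.
  have [n _ nE] : \forall n \near \oo, (b - a) / 2 / e <= n%:R.
    exact: nbhs_infty_ger.
  exists n => //; rewrite /F/= in_itv/=.
  have de : d n <= e.
    rewrite /d ler_pdivrMr// -ler_pdivrMl// mulrC.
    by apply: le_trans (nE n (leqnn n)) _; rewrite ler_nat ltnW.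
  move: de; rewrite le_min => /andP[h1 h2].
  by rewrite -lerBrDl h1 lerBrDl -lerBrDr.
rewrite FU.
have cv : (fun n => \int[mu]_(x in F n) (g x)%:E)%E @ \oo -->
    (\int[mu]_(x in \bigcup_n F n) (g x)%:E)%E.
  apply: ge0_nondecreasing_set_cvg_integral.
  - apply/nondecreasing_seqP => n; apply/subsetPset => x; rewrite /F/= !in_itv/=.
    have dd : d n.+1 <= d n.
      by rewrite /d ler_wpM2l ?divr_ge0 ?(ltW ba)// lef_pV2 ?posrE// ler_nat.
    by move=> /andP[h1 h2]; apply/andP; split; lra.
  - by move=> n; exact: measurable_itv.
  - move=> n; apply/measurable_EFinP.
    apply: (@measurable_funS _ _ _ _ `]a, b[%classic) => //.
      by move=> x /Fin; rewrite /= in_itv.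
    exact: measurable_fun_oo.
  - by move=> n x /Fin; rewrite lee_fin; exact: g0.
rewrite -(cvg_lim _ cv)//; apply: lime_le; first exact: cvgP cv.
apply: nearW => n.
have cG x : a < x < b -> {for x, continuous G}.
  move=> /dG dGx; apply: differentiable_continuous; apply/derivable1_diffP.
  by have [] := dGx.
have dn : a + d n < b - d n by have := d1 n; lra.
have dl : a < a + d n < b by have := d1 n; have := d0 n; lra.
have dr : a < b - d n < b by have := d1 n; have := d0 n; lra.
rewrite (@continuous_FTC2 _ g G)//.
- by rewrite -EFinB lee_fin; exact: GM.
- apply: continuous_in_subspaceT => x; rewrite inE => /Fin; exact: cg.
- split.
  + move=> x; rewrite in_itv/= => /andP[h1 h2].
    have /dG [] // : a < x < b by apply: (Fin n); rewrite /F/= in_itv/= !ltW.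
  + by apply: cvg_at_right_filter; exact: cG.
  + by apply: cvg_at_left_filter; exact: cG.
- move=> x; rewrite in_itv/= => /andP[h1 h2].
  have abx : a < x < b by apply: (Fin n); rewrite /F/= in_itv/= !ltW.
  by rewrite derive1E; have := dG _ abx => dGx; exact: derive_val.
Qed.

End Improper.

Section Beta.
Context {R : realType}.
Implicit Types (s t x y : R).
Local Notation mu := (@lebesgue_measure R).

Definition qrt s : R := s `^ 4^-1.

Lemma qrt_ge0 s : 0 <= qrt s. Proof. exact: powR_ge0. Qed.

Lemma qrt_gt0 s : 0 < s -> 0 < qrt s. Proof. exact: powR_gt0. Qed.

Lemma qrt0 : qrt 0 = 0. Proof. by rewrite /qrt powR0. Qed.

Lemma qrtX4 s : 0 <= s -> qrt s ^+ 4 = s.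
Proof.
by move=> s0; rewrite /qrt -powR_mulrn ?powR_ge0// -powRrM mulVf// powRr1.
Qed.

Lemma qrtM s t : 0 <= s -> 0 <= t -> qrt (s * t) = qrt s * qrt t.
Proof. exact: powRM. Qed.

Lemma le_qrt s t : 0 <= s -> s <= t -> qrt s <= qrt t.
Proof.
move=> s0 st; apply: ge0_ler_powR => //; rewrite nnegrE//.
exact: le_trans st.
Qed.

Lemma qrt1 : qrt 1 = 1. Proof. by rewrite /qrt powR1. Qed.

Lemma is_derive_qrt s : 0 < s -> is_derive s 1 qrt (4 * qrt s ^+ 3)^-1.
Proof.
move=> s0; have := is_derive1_powR 4^-1 s0; rewrite (_ : 4^-1 * _ = (4 * qrt s ^+ 3)^-1)//.
have q0 := qrt_gt0 s0.
rewrite powRB ?(gt_eqF s0) ?implybT// powRr1 ?(ltW s0)// -/(qrt s) -{2}(qrtX4 (ltW s0)).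
by field; rewrite gt_eqF.
Qed.

Lemma qrt_half t : 0 < t -> qrt t <= 2 * qrt (t / 2).
Proof.
move=> t0; have -> : qrt t = qrt 2 * qrt (t / 2).
  rewrite -qrtM//; last by rewrite ltW// divr_gt0.
  by congr qrt; field.
rewrite ler_wpM2r ?qrt_ge0//.
have q2 : qrt 2 ^+ 4 = 2 by rewrite qrtX4.
rewrite leNgt; apply/negP => h; have : 2 ^+ 4 <= qrt 2 ^+ 4 :> R.
  by apply: lerXn2r; rewrite ?nnegrE ?qrt_ge0// ltW.
by rewrite q2; lra.
Qed.

Lemma continuous_expr (f : R -> R) n x : {for x, continuous f} ->
  {for x, continuous (fun z => f z ^+ n)}.
Proof.
by move=> cf; apply: (@continuous_comp _ _ _ f (fun y => y ^+ n)) => //;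
  exact: exprn_continuous.
Qed.

(** s^(-3/4) (t - s)^(-1/2): the cube of a slope of size s^(-1/4), times the
smoothing rate of d_xx S(t - s). *)
Definition beta_kernel t s : R := (qrt s ^+ 3 * qrt (t - s) ^+ 2)^-1.

Lemma beta_kernel_ge0 t s : 0 <= beta_kernel t s.
Proof. by rewrite invr_ge0 mulr_ge0// exprn_ge0// qrt_ge0. Qed.

Lemma continuous_qrt s : 0 < s -> {for s, continuous qrt}.
Proof.
move=> s0; apply: differentiable_continuous; apply/derivable1_diffP.
by have [] := is_derive_qrt s0.
Qed.

Lemma continuous_qrtB t s : s < t -> {for s, continuous (fun z => qrt (t - z))}.
Proof.
move=> st; apply: (@continuous_comp _ _ _ (fun z => t - z) qrt).
  by apply: cvgB; [exact: cvg_cst|exact: cvg_id].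
by apply: continuous_qrt; rewrite subr_gt0.
Qed.

Lemma continuous_beta_kernel t s : 0 < s < t -> {for s, continuous (beta_kernel t)}.
Proof.
move=> /andP[s0 st]; rewrite /beta_kernel.
have q1 := qrt_gt0 s0.
have q2 : 0 < qrt (t - s) by rewrite qrt_gt0 ?subr_gt0.
apply: cvgV; first by rewrite gt_eqF// mulr_gt0// exprn_gt0.
have c1 := @continuous_expr qrt 3 s (continuous_qrt s0).
have c2 := @continuous_expr (fun z => qrt (t - z)) 2 s (continuous_qrtB st).
exact: cvgM c1 c2.
Qed.

Lemma integral_qrtVX3 t : 0 < t ->
  (\int[mu]_(s in `]0%R, t[) ((qrt s ^+ 3)^-1)%:E <= (4 * qrt t)%:E)%E.
Proof.
move=> t0; apply: (@improper_FTC2_le _ _ (fun s => 4 * qrt s) _ _ _ t0).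
- by move=> s _; rewrite invr_ge0 exprn_ge0// qrt_ge0.
- move=> s /andP[s0 _]; have q0 := qrt_gt0 s0.
  have ds := is_derive_qrt s0.
  by apply: is_derive_eq; rewrite /GRing.scale/=; field; rewrite gt_eqF.
- move=> s /andP[s0 _]; have q0 := qrt_gt0 s0.
  apply: cvgV; first by rewrite gt_eqF// exprn_gt0.
  exact: (@continuous_expr qrt 3 s (continuous_qrt s0)).
- move=> x y /andP[x0 xt] /andP[y0 yt]; rewrite -mulrBr ler_wpM2l//.
  by apply: le_trans (le_qrt (ltW y0) (ltW yt)); rewrite gerBl qrt_ge0.
Qed.

Lemma integral_qrtBVX2 t : 0 < t ->
  (\int[mu]_(s in `]0%R, t[) ((qrt (t - s) ^+ 2)^-1)%:E <= (2 * qrt t ^+ 2)%:E)%E.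
Proof.
move=> t0; apply: (@improper_FTC2_le _ _ (fun s => - (2 * qrt (t - s) ^+ 2)) _ _ _ t0).
- by move=> s _; rewrite invr_ge0 exprn_ge0// qrt_ge0.
- move=> s /andP[_ st]; have st0 : 0 < t - s by rewrite subr_gt0.
  have q0 := qrt_gt0 st0.
  have ds := is_derive_qrt st0.
  have dq : is_derive s 1 (fun z => qrt (t - z)) (- (4 * qrt (t - s) ^+ 3)^-1).
    by apply: is_derive_eq; rewrite ?/GRing.scale/=; ring.
  by apply: is_derive_eq; rewrite /GRing.scale/=; field; rewrite gt_eqF.
- move=> s /andP[_ st]; have q0 : 0 < qrt (t - s) by rewrite qrt_gt0 ?subr_gt0.
  apply: cvgV; first by rewrite gt_eqF// exprn_gt0.
  exact: (@continuous_expr (fun z => qrt (t - z)) 2 s (continuous_qrtB st)).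
- move=> x y /andP[x0 xt] /andP[y0 yt]; rewrite opprK addrC -mulrBr ler_wpM2l//.
  apply: (@le_trans _ _ (qrt (t - x) ^+ 2)); first by rewrite gerBl exprn_ge0// qrt_ge0.
  rewrite lerXn2r ?nnegrE ?qrt_ge0// le_qrt ?subr_ge0 ?(ltW xt)//.
  by rewrite gerBl ltW.
Qed.

(** On each half of ]0, t[ only one of the two factors is singular.  The result
t^(-1/4) is the critical rate: it is the one assumed for the slope. *)
Lemma integral_beta_kernel t : 0 < t ->
  (\int[mu]_(s in `]0%R, t[) (beta_kernel t s)%:E <= (32 / qrt t)%:E)%E.
Proof.
move=> t0.
have q0 := qrt_gt0 t0.
have h0 : 0 < t / 2 by rewrite divr_gt0.
have qh0 := qrt_gt0 h0.
have qh := qrt_half t0.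
pose A := (qrt (t / 2) ^+ 2)^-1; pose B := (qrt (t / 2) ^+ 3)^-1.
have A0 : 0 <= A by rewrite invr_ge0 exprn_ge0// ltW.
have B0 : 0 <= B by rewrite invr_ge0 exprn_ge0// ltW.
have m1 : measurable_fun `]0, t[ (fun s => (qrt s ^+ 3)^-1).
  apply: measurable_fun_oo => s /andP[s0 _]; have q1 := qrt_gt0 s0.
  apply: cvgV; first by rewrite gt_eqF// exprn_gt0.
  exact: (@continuous_expr qrt 3 s (continuous_qrt s0)).
have m2 : measurable_fun `]0, t[ (fun s => (qrt (t - s) ^+ 2)^-1).
  apply: measurable_fun_oo => s /andP[_ st].
  have q1 : 0 < qrt (t - s) by rewrite qrt_gt0 ?subr_gt0.
  apply: cvgV; first by rewrite gt_eqF// exprn_gt0.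
  exact: (@continuous_expr (fun z => qrt (t - z)) 2 s (continuous_qrtB st)).
apply: (@le_trans _ _ (\int[mu]_(s in `]0%R, t[)
   (A%:E * ((qrt s ^+ 3)^-1)%:E + B%:E * ((qrt (t - s) ^+ 2)^-1)%:E))%E).
  apply: ge0_le_integral => //.
  - by move=> s _; rewrite lee_fin beta_kernel_ge0.
  - by apply/measurable_EFinP; apply: measurable_fun_oo; exact: continuous_beta_kernel.
  - by apply: emeasurable_funD; apply: measurable_funeM; exact/measurable_EFinP.
  - move=> s; rewrite /= in_itv/= => /andP[s0 st]; rewrite -!EFinM -EFinD lee_fin.
    have st0 : 0 < t - s by rewrite subr_gt0.
    have q1 := qrt_gt0 s0. have q2 := qrt_gt0 st0.
    rewrite /beta_kernel invfM.
    have p1 : 0 <= (qrt s ^+ 3)^-1 by rewrite invr_ge0 exprn_ge0// ltW.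
    have p2 : 0 <= (qrt (t - s) ^+ 2)^-1 by rewrite invr_ge0 exprn_ge0// ltW.
    have [sh|hs] := leP s (t / 2).
      rewrite mulrC; apply: le_trans (_ : A * (qrt s ^+ 3)^-1 <= _).
        rewrite ler_wpM2r// lef_pV2 ?posrE ?exprn_gt0//.
        by rewrite lerXn2r ?nnegrE ?qrt_ge0// le_qrt ?(ltW h0)//; lra.
      by rewrite lerDl mulr_ge0.
    apply: le_trans (_ : B * (qrt (t - s) ^+ 2)^-1 <= _).
      rewrite ler_wpM2r// lef_pV2 ?posrE ?exprn_gt0//.
      by rewrite lerXn2r ?nnegrE ?qrt_ge0// le_qrt ?(ltW h0)// ltW.
    by rewrite lerDr mulr_ge0.
rewrite ge0_integralD//=; last 4 first.
- by move=> s _; rewrite -EFinM lee_fin mulr_ge0// invr_ge0 exprn_ge0// qrt_ge0.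
- by apply: measurable_funeM; exact/measurable_EFinP.
- by move=> s _; rewrite -EFinM lee_fin mulr_ge0// invr_ge0 exprn_ge0// qrt_ge0.
- by apply: measurable_funeM; exact/measurable_EFinP.
rewrite !ge0_integralZl_EFin//; last 4 first.
- by move=> s _; rewrite lee_fin invr_ge0 exprn_ge0// qrt_ge0.
- exact/measurable_EFinP.
- by move=> s _; rewrite lee_fin invr_ge0 exprn_ge0// qrt_ge0.
- exact/measurable_EFinP.
apply: le_trans (leeD (lee_wpmul2l _ (integral_qrtVX3 t0)) (lee_wpmul2l _ (integral_qrtBVX2 t0))) _.
- by rewrite lee_fin.
- by rewrite lee_fin.
rewrite -!EFinM -EFinD lee_fin.
have A4 : A <= 4 / qrt t ^+ 2.
  rewrite /A -div1r ler_pdivrMr ?exprn_gt0// mulrAC ler_pdivlMr ?exprn_gt0// mul1r.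
  by nra.
have B8 : B <= 8 / qrt t ^+ 3.
  rewrite /B -div1r ler_pdivrMr ?exprn_gt0// mulrAC ler_pdivlMr ?exprn_gt0// mul1r.
  have -> : 8 * qrt (t / 2) ^+ 3 = (2 * qrt (t / 2)) ^+ 3 by ring.
  by rewrite lerXn2r ?nnegrE ?mulr_ge0 ?qrt_ge0.
have -> : 32 / qrt t = 4 / qrt t ^+ 2 * (4 * qrt t) + 8 / qrt t ^+ 3 * (2 * qrt t ^+ 2).
  by field; rewrite gt_eqF.
by rewrite lerD// ler_wpM2r ?mulr_ge0 ?exprn_ge0 ?qrt_ge0.
Qed.

Lemma integrable_beta_kernel t : 0 < t ->
  mu.-integrable `]0, t[ (EFin \o beta_kernel t).
Proof.
move=> t0; apply/integrableP; split.
  by apply/measurable_EFinP; apply: measurable_fun_oo; exact: continuous_beta_kernel.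
apply: le_lt_trans (_ : _ <= (32 / qrt t)%:E)%E _; last exact: ltry.
apply: le_trans (integral_beta_kernel t0); rewrite le_eqVlt; apply/orP; left; apply/eqP.
by apply: eq_integral => s _; rewrite /= ger0_norm// beta_kernel_ge0.
Qed.

Lemma Rintegral_beta_kernel t : 0 < t ->
  \int[mu]_(s in `]0, t[) beta_kernel t s <= 32 / qrt t.
Proof.
move=> t0; rewrite -lee_fin /Rintegral fineK; first exact: integral_beta_kernel.
exact: integrable_fin_num (integrable_beta_kernel t0).
Qed.

End Beta.

(** * Linearity of the Fourier modes and of the semigroup *)

Section Linearity.
Context {R : realType}.
Implicit Types (f g : R -> R) (a b x y z B : R).

Lemma continuous_lin a b f g : continuous f -> continuous g ->
  continuous (fun z => a * f z + b * g z).
Proof.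
move=> cf cg z; apply: cvgD; (apply: cvgM; first exact: cvg_cst); [exact: cf|exact: cg].
Qed.

Let circle_int_lin a b (c : R -> R) f g : continuous f -> continuous g -> continuous c ->
  circle_int (fun z => (a * f z + b * g z) * c z) =
  a * circle_int (fun z => f z * c z) + b * circle_int (fun z => g z * c z).
Proof.
move=> cf cg cc.
have c1 : continuous (fun z => f z * c z) by exact: continuous_mulr.
have c2 : continuous (fun z => g z * c z) by exact: continuous_mulr.
have cst (e : R) (k : R -> R) : continuous k -> continuous (fun z => e * k z).
  by move=> ck; apply: continuous_mulr => // z; exact: cvg_cst.
rewrite -!circle_intZ// -circle_intD; [|exact: cst..].
by congr circle_int; apply/funext => z; ring.
Qed.

Let continuous_cosM (k : nat) : continuous (fun z : R => cos (k%:R * z)).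
Proof.
move=> z; apply: continuous_comp; last exact: continuous_cos.
exact: mulrl_continuous.
Qed.

Let continuous_sinM (k : nat) : continuous (fun z : R => sin (k%:R * z)).
Proof.
move=> z; apply: continuous_comp; last exact: continuous_sin.
exact: mulrl_continuous.
Qed.

Lemma fcos_lin a b f g k : continuous f -> continuous g ->
  fcos (fun z => a * f z + b * g z) k = a * fcos f k + b * fcos g k.
Proof. by move=> cf cg; rewrite /fcos circle_int_lin//; ring. Qed.

Lemma fsin_lin a b f g k : continuous f -> continuous g ->
  fsin (fun z => a * f z + b * g z) k = a * fsin f k + b * fsin g k.
Proof. by move=> cf cg; rewrite /fsin circle_int_lin//; ring. Qed.

Lemma dfmode_lin a b f g k x : continuous f -> continuous g ->
  dfmode (fun z => a * f z + b * g z) k x = a * dfmode f k x + b * dfmode g k x.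
Proof. by move=> cf cg; rewrite /dfmode fcos_lin// fsin_lin//; ring. Qed.

Lemma dfmode_close f g B k x : continuous f -> continuous g ->
  (forall z, `|f z - g z| <= B) -> `|dfmode f k x - dfmode g k x| <= 4 * B * k%:R.
Proof.
move=> cf cg fg; have -> : dfmode f k x - dfmode g k x =
    dfmode (fun z => 1 * f z + -1 * g z) k x by rewrite dfmode_lin// mul1r mulN1r.
apply: normr_dfmode; first exact: continuous_lin.
by move=> z; rewrite mul1r mulN1r.
Qed.

(** The positivity of r and the bounds on f and g make both series converge. *)
Lemma ddsemigroupD r f g B C x : 0 < r -> continuous f -> continuous g ->
  (forall z, `|f z| <= B) -> (forall z, `|g z| <= C) ->
  ddsemigroup (r ^+ 4) (fun z => f z + g z) x =
  ddsemigroup (r ^+ 4) f x + ddsemigroup (r ^+ 4) g x.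
Proof.
move=> r0 cf cg fB gC.
rewrite /ddsemigroup -lim_seriesD.
- congr (limn (series _)); apply/funext => k.
  by rewrite fmodeD// [in RHS]fctE; ring.
- exact: cvg_ddsemigroup cf fB r0 x.
- exact: cvg_ddsemigroup cg gC r0 x.
Qed.

End Linearity.

(** * Time regularity of mild solutions *)

Section Mild.
Context {R : realType}.
Variables (nu : R) (h0 : R -> R) (h : R -> R -> R).
Hypotheses (nu0 : 0 < nu) (mild : mild_solution nu h0 h).
Implicit Types (s t x y z m e : R).
Local Notation mu := (@lebesgue_measure R).

(** The slope weighted by t^(1/4), which a mild solution keeps continuous in time
down to t = 0. *)
Definition wslope t x : R := qrt t * derive1 (h t) x.
Definition flux t x : R := derive1 (h t) x ^+ 3 - derive1 (h t) x.

Lemma continuous_wslope t : 0 <= t -> continuous (wslope t).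
Proof.
move=> t0.
have T0 : 0 < t + 1 by rewrite ltr_wpDl.
have := mild_C1 mild T0; rewrite /Ct => /(_ t).
rewrite in_itv/= t0 lerDl ler01 => /(_ isT) [[_ cW] _]; exact: cW.
Qed.

(** Convergence for the essential supremum is uniform convergence, because the
functions are continuous in space. *)
Lemma wslope_time t e : 0 <= t -> 0 < e ->
  exists2 d, 0 < d & forall s, 0 <= s -> `|s - t| < d ->
    forall x, `|wslope s x - wslope t x| < e.
Proof.
move=> t0 e0.
have T0 : 0 < t + 1 by rewrite ltr_wpDl.
have := mild_C1 mild T0; rewrite /Ct => /(_ t).
rewrite in_itv/= t0 lerDl ler01 => /(_ isT) [_ cv].
have ne : nbhs (0%E : \bar R) [set y : \bar R | (y < e%:E)%E].
  by apply: open_nbhs_nbhs; split; [exact: open_ereal_lt_ereal|rewrite /= lte_fin].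
have := cv _ ne; rewrite /nbhs/= => /nbhs_ballP[d /= d0 Hd].
exists (Num.min d 1); first by rewrite lt_min d0 ltr01.
move=> s s0; rewrite lt_min => /andP[sd s1] x.
have sT : s \in `[0, t + 1].
  by rewrite in_itv/= s0/= -lerBlDl; apply: le_trans (ler_norm _) (ltW s1).
have := Hd s; rewrite /ball/= distrC => /(_ sd sT) H.
rewrite -lte_fin; apply: le_lt_trans H.
have cs := continuous_wslope s0; have ct := continuous_wslope t0.
apply: (@le_Linf_norm _ (fun x => wslope s x - wslope t x)) => y.
by apply: cvgB; [exact: cs|exact: ct].
Qed.

Lemma derive1_wslope t x : 0 < t -> derive1 (h t) x = wslope t x / qrt t.
Proof. by move=> t0; rewrite /wslope mulrAC mulfV ?mul1r// gt_eqF// qrt_gt0. Qed.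

Lemma continuous_slope t : 0 < t -> continuous (derive1 (h t)).
Proof.
move=> t0; have -> : derive1 (h t) = fun x => (qrt t)^-1 * wslope t x.
  by apply/funext => x; rewrite derive1_wslope// mulrC.
by apply: continuous_mulr; [move=> x; exact: cvg_cst|apply: continuous_wslope; exact: ltW].
Qed.

Lemma continuous_flux t : 0 < t -> continuous (flux t).
Proof.
move=> t0 x; have cu := @continuous_slope t t0 x.
by apply: cvgB => //; exact: continuous_expr.
Qed.

Lemma fluxE t : 0 < t -> flux t =
  fun x => (qrt t ^+ 3)^-1 * wslope t x ^+ 3 + (- (qrt t)^-1) * wslope t x.
Proof.
move=> t0; apply/funext => x; rewrite /flux derive1_wslope//; field.
by rewrite gt_eqF// qrt_gt0.
Qed.

(** u^3 - u = t^(-3/4) w^3 - t^(-1/4) w in terms of the weighted slope w. *)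
Lemma normr_flux m t x : 0 < t -> (forall x, `|wslope t x| <= m) ->
  `|flux t x| <= (m ^+ 3 + m * qrt t ^+ 2) / qrt t ^+ 3.
Proof.
move=> t0 wm; have q0 := qrt_gt0 t0; rewrite fluxE//.
have -> : (m ^+ 3 + m * qrt t ^+ 2) / qrt t ^+ 3 =
  (qrt t ^+ 3)^-1 * m ^+ 3 + (qrt t)^-1 * m by field; rewrite gt_eqF.
apply: le_trans (ler_normD _ _) _; 
rewrite (normrM (qrt t ^+ 3)^-1) (normrM (- (qrt t)^-1)) normrN normrX.
rewrite (@ger0_norm _ (qrt t ^+ 3)^-1) ?invr_ge0 ?exprn_ge0 ?(ltW q0)//.
rewrite (@ger0_norm _ (qrt t)^-1) ?invr_ge0 ?(ltW q0)//.
rewrite lerD// ler_wpM2l ?invr_ge0 ?exprn_ge0 ?(ltW q0)//.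
by rewrite lerXn2r ?nnegrE//; exact: le_trans (wm x).
Qed.

Lemma dfmode_continuous (f : R -> R -> R) k y s :
  (forall e, 0 < e -> \forall r \near s,
    [/\ continuous (f r), continuous (f s) & forall x, `|f r x - f s x| <= e]) ->
  {for s, continuous (fun r => dfmode (f r) k y)}.
Proof.
move=> H; apply/cvgrPdist_le => e e0.
have e1 : 0 < e / (4 * k.+1%:R) by rewrite divr_gt0.
near=> r; have [cr cs Hr] : [/\ continuous (f r), continuous (f s) &
    forall x, `|f r x - f s x| <= e / (4 * k.+1%:R)] by near: r; exact: H.
rewrite distrC; apply: le_trans (dfmode_close k y cr cs Hr) _.
apply: (@le_trans _ _ (4 * (e / (4 * k.+1%:R)) * k.+1%:R)).
  by rewrite ler_wpM2l ?ler_nat// mulr_ge0// ltW.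
move: (ltr0Sn R k) => /gt_eqF/negbT; move: (k.+1%:R) => K K0.
by rewrite le_eqVlt; apply/orP; left; apply/eqP; field.
Unshelve. all: by end_near. Qed.

(** This is used only to make the Duhamel integrand measurable in time; factoring
out the powers of t leaves the weighted slope, whose continuity is known. *)
Lemma continuous_dfmode_flux T m k y : 0 < T ->
  (forall s x, 0 < s -> s <= T -> `|wslope s x| <= m) ->
  forall s, 0 < s < T -> {for s, continuous (fun s => dfmode (flux s) k y)}.
Proof.
move=> T0 wm s /andP[s0 sT].
have q0 := qrt_gt0 s0.
have m0 : 0 <= m by apply: le_trans (wm s 0 s0 (ltW sT)).
have cW3 r : 0 <= r -> continuous (fun x => wslope r x ^+ 3).
  by move=> r0 x; apply: continuous_expr; exact: continuous_wslope.
have nearW e : 0 < e -> \forall r \near s, [/\ 0 < r, r <= T &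
    forall x, `|wslope r x - wslope s x| <= e].
  move=> e0; have [d d0 Hd] := wslope_time (ltW s0) e0.
  near=> r; have r0 : 0 < r by near: r; exact: lt_nbhsr.
  split => //; first by near: r; apply: filterS (lt_nbhsl sT) => z; exact: ltW.
  move=> x; apply: ltW; apply: Hd; first exact: ltW.
  by rewrite distrC; near: r; exact: cvgr_dist_lt.
have c1 : {for s, continuous (fun r => dfmode (wslope r) k y)}.
  apply: dfmode_continuous => e /nearW; apply: filterS => r [r0 rT Hr].
  by split=> //; [exact: continuous_wslope (ltW r0)|exact: continuous_wslope (ltW s0)].
have c3 : {for s, continuous (fun r => dfmode (fun x => wslope r x ^+ 3) k y)}.
  apply: dfmode_continuous => e e0.
  have M0 : 0 < 3 * m ^+ 2 + 1 by rewrite ltr_wpDl// mulr_ge0// exprn_ge0.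
  have /nearW : 0 < e / (3 * m ^+ 2 + 1) by rewrite divr_gt0.
  apply: filterS => r [r0 rT Hr].
  split; [exact: cW3 (ltW r0)|exact: cW3 (ltW s0)|move=> x].
  have := Hr x; rewrite ler_pdivlMr// => H; apply: le_trans H.
  have -> : wslope r x ^+ 3 - wslope s x ^+ 3 = (wslope r x - wslope s x) *
    (wslope r x ^+ 2 + wslope r x * wslope s x + wslope s x ^+ 2) by ring.
  rewrite normrM ler_wpM2l//.
  have a1 := wm r x r0 rT; have a2 := wm s x s0 (ltW sT).
  apply: (@le_trans _ _ (m ^+ 2 + m * m + m ^+ 2)); last by rewrite expr2; lra.
  apply: le_trans (ler_normD _ _) _; apply: lerD; last by rewrite normrX lerXn2r.
  apply: le_trans (ler_normD _ _) _; apply: lerD; first by rewrite normrX lerXn2r.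
  by rewrite normrM ler_pM.
have cq : {for s, continuous (fun r => (qrt r ^+ 3)^-1)}.
  apply: cvgV; first by rewrite gt_eqF// exprn_gt0.
  exact: (@continuous_expr _ qrt 3 s (continuous_qrt s0)).
have cq1 : {for s, continuous (fun r => - (qrt r)^-1)}.
  by apply: cvgN; apply: cvgV; [rewrite gt_eqF|exact: continuous_qrt].
have E r : 0 < r -> dfmode (flux r) k y =
   (qrt r ^+ 3)^-1 * dfmode (fun x => wslope r x ^+ 3) k y + - (qrt r)^-1 * dfmode (wslope r) k y.
  by move=> r0; rewrite fluxE// dfmode_lin//; [exact: cW3 (ltW r0)|exact: continuous_wslope (ltW r0)].
rewrite /prop_for/continuous_at.
rewrite E//.
apply: cvg_trans; last first.
  exact: cvgD (cvgM cq c3) (cvgM cq1 c1).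
apply: near_eq_cvg.
near=> r; apply/esym/E; near: r; exact: lt_nbhsr.
Unshelve. all: by end_near. Qed.

End Mild.

(** * The Duhamel formula for the slope *)

Section Duhamel.
Context {R : realType}.
Variables (nu : R) (h0 : R -> R) (h : R -> R -> R).
Hypotheses (nu0 : 0 < nu) (mild : mild_solution nu h0 h).
Implicit Types (s t x y z e r : R).
Local Notation mu := (@lebesgue_measure R).

Variables (t m : R).
Hypotheses (t0 : 0 < t) (t1 : t <= 1) (nut : nu * t <= 1).
Hypothesis (wm : forall s x, 0 < s -> s <= t -> `|wslope h s x| <= m).

Let Phi s y := dsemigroup (nu * (t - s)) (flux h s) y.

Let dtime s := nu * (t - s).

Let m0 : 0 <= m.
Proof. by apply: le_trans (wm 0 t0 (lexx t)). Qed.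

Let dtime_qrt s : 0 < s < t -> [/\ 0 < qrt (dtime s), qrt (dtime s) <= 1 &
  qrt (dtime s) ^+ 4 = dtime s].
Proof.
move=> /andP[s0 st]; have d0 : 0 < dtime s by rewrite mulr_gt0// subr_gt0.
split; [exact: qrt_gt0| |by rewrite qrtX4// ltW].
rewrite -(@qrt1 R); apply: le_qrt; first exact: ltW.
by apply: le_trans nut; rewrite ler_pM2l// gerBl ltW.
Qed.

Let flux_le s x : 0 < s < t ->
  `|flux h s x| <= (m ^+ 3 + m) / qrt s ^+ 3.
Proof.
move=> /andP[s0 st]; have q0 := qrt_gt0 s0.
apply: le_trans (normr_flux _ s0 (fun x => wm x s0 (ltW st))) _.
rewrite ler_wpM2r ?invr_ge0 ?exprn_ge0 ?(ltW q0)// lerD2l -[leRHS]mulr1 ler_wpM2l//.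
rewrite exprn_ile1 ?(ltW q0)// -(@qrt1 R) le_qrt ?(ltW s0)//.
exact: le_trans (ltW st) t1.
Qed.

Lemma is_derive_dtime s y : 0 < s < t ->
  is_derive y 1 (biharmonic_semigroup nu (t - s) (flux h s)) (Phi s y).
Proof.
move=> st; have [r0 _ rE] := dtime_qrt st; have /andP[s0 _] := st.
have := is_derive_semigroup (continuous_flux mild s0) (fun z => flux_le z st) r0 y.
by rewrite rE.
Qed.

Lemma is_derive_Phi s y : 0 < s < t ->
  is_derive y 1 (Phi s) (ddsemigroup (nu * (t - s)) (flux h s) y).
Proof.
move=> st; have [r0 _ rE] := dtime_qrt st; have /andP[s0 _] := st.
have := is_derive_dsemigroup (continuous_flux mild s0) (fun z => flux_le z st) r0 y.
by rewrite rE.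
Qed.

Lemma measurable_Phi y : measurable_fun `]0, t[ (Phi ^~ y).
Proof.
pose u n s := series (fun k => damp (dtime s) k * dfmode (flux h s) k y) n.
apply: (@measurable_fun_cvg _ _ _ _ u); last first.
  move=> s; rewrite /= in_itv/= => st; have [r0 _ rE] := dtime_qrt st.
  have /andP[s0 _] := st.
  have := @cvg_dsemigroup _ _ _ _ (continuous_flux mild s0) (fun z => flux_le z st) r0 y.
  by rewrite rE.
have mterm k : measurable_fun `]0, t[ (fun s => damp (dtime s) k * dfmode (flux h s) k y).
  apply: measurable_funM; last first.
    by apply: measurable_fun_oo => s; exact: (continuous_dfmode_flux mild t0 wm).
  apply: measurable_fun_oo => s _.
  apply: (@continuous_comp _ _ _ (fun s => - (dtime s * k%:R ^+ 4)) expR).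
    apply: cvgN; apply: cvgM; last exact: cvg_cst.
    by apply: cvgM; [exact: cvg_cst|apply: cvgB; [exact: cvg_cst|exact: cvg_id]].
  exact: continuous_expR.
elim=> [|n IHn].
  rewrite (_ : u 0%N = fun=> 0); first exact: measurable_cst.
  by apply/funext => s; rewrite /u /series/= big_geq.
rewrite (_ : u n.+1 = fun s => u n s + damp (dtime s) n * dfmode (flux h s) n y).
  exact: measurable_funD.
by apply/funext => s; rewrite /u /series/= big_nat_recr.
Qed.

Lemma integrable_Phi y : mu.-integrable `]0, t[ (EFin \o Phi ^~ y).
Proof.
pose C := 2048 * (m ^+ 3 + m) / qrt nu ^+ 2.
have qn := qrt_gt0 nu0.
have M0 : 0 <= m ^+ 3 + m by rewrite addr_ge0// exprn_ge0.
have C0 : 0 <= C.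
  by apply: divr_ge0; [exact: (mulr_ge0 (ler0n _ _) M0)|rewrite exprn_ge0// ltW].
have CE : C = 2048 * (m ^+ 3 + m) / qrt nu ^+ 2 by [].
clearbody C.
apply: (@le_integrable _ _ _ mu _ _ _ (fun s => C%:E * (beta_kernel t s)%:E)%E) => //.
- by apply/measurable_EFinP; exact: measurable_Phi.
- move=> s; rewrite /= in_itv/= => st; have [r0 r1 rE] := dtime_qrt st.
  have /andP[s0 st'] := st.
  rewrite /= lee_fin [leRHS]ger0_norm ?mulr_ge0 ?beta_kernel_ge0//.
  have := normr_dsemigroup (continuous_flux mild s0) (fun z => flux_le z st) r0 y r1.
  rewrite rE => H; apply: le_trans H _.
  rewrite /dtime qrtM ?(ltW nu0) ?subr_ge0 ?(ltW st')// CE /beta_kernel exprMn.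
  have q1 := qrt_gt0 s0.
  have q2 : 0 < qrt (t - s) by rewrite qrt_gt0// subr_gt0.
  rewrite le_eqVlt; apply/orP; left; apply/eqP.
  move: (2048) => c; field; rewrite !gt_eqF//.
- by apply: integrableZl => //; exact: integrable_beta_kernel.
Qed.

Lemma duhamel_Phi y :
  h t y - biharmonic_semigroup nu t h0 y = \int[mu]_(s in `]0, t[) Phi s y.
Proof.
rewrite (mild_duhamel mild y t0) addrC addKr /Rintegral.
have E : {in `]0, t[%classic, (fun s => (derive1 (biharmonic_semigroup nu (t - s)
    (fun y => derive1 (h s) y ^+ 3 - derive1 (h s) y)) y)%:E) =1
    (fun s => (Phi s y)%:E)}.
  move=> s; rewrite inE/= in_itv/= => st; congr EFin.
  by rewrite derive1E; apply: derive_val; exact: is_derive_dtime.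
rewrite integral_itv_bndoo; last first.
  apply: eq_measurable_fun; last first.
    by apply/measurable_EFinP; exact: (measurable_Phi y).
  by move=> s sD; rewrite E.
by congr fine; exact: eq_integral.
Qed.

(** The difference quotients of h t minus those of the linear evolution are
integrals in time of difference quotients of d_x S(t - s) (u^3 - u)(s); by the
mean value theorem these are values of d_xx S near x, which g dominates. *)
Lemma duhamel_slope x l g G d :
  is_derive x 1 (biharmonic_semigroup nu t h0) l ->
  mu.-integrable `]0, t[ (EFin \o g) ->
  \int[mu]_(s in `]0, t[) g s <= G -> 0 < d ->
  (forall s y, 0 < s < t -> `|y - x| < d ->
     `|ddsemigroup (nu * (t - s)) (flux h s) y| <= g s) ->
  `|derive1 (h t) x - l| <= G.
Proof.
move=> dl ig gG d0 Hg.
have dh : is_derive x 1 (h t) (derive1 (h t) x).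
  by rewrite derive1E; apply: DeriveDef => //; apply: (mild_derivable mild); exact: ltW.
apply: (normr_derive_le d0 (is_deriveB dh dl)) => y yx.
rewrite !fctE !duhamel_Phi -RintegralB//; [|exact: integrable_Phi..].
have iB : mu.-integrable `]0, t[ (EFin \o (fun s => Phi s y - Phi s x)).
  rewrite (_ : EFin \o _ = (EFin \o Phi ^~ y) \- (EFin \o Phi ^~ x))%E.
    by apply: integrableB => //; exact: integrable_Phi.
  by apply/funext => s; rewrite /= EFinB.
apply: le_trans (le_normr_Rintegral _ iB) _ => //.
have ig' : mu.-integrable `]0, t[ (EFin \o (fun s => g s * `|y - x|)).
  rewrite (_ : EFin \o _ = fun s => (g s)%:E * (`|y - x|)%:E)%E.
    exact: integrableZr.
  by apply/funext => s; rewrite /= EFinM.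
apply: (@le_trans _ _ (\int[mu]_(s in `]0, t[) (g s * `|y - x|))).
  apply: le_Rintegral => //.
    rewrite (_ : EFin \o _ = abse \o (EFin \o (fun s => Phi s y - Phi s x))).
      exact: integrable_abse.
    by apply/funext => s.
  move=> s; rewrite /= in_itv/= => st.
  have [c cx ->] := mean_value_near x y (fun z => is_derive_Phi z st).
  by rewrite normrM ler_wpM2r//; apply: Hg => //; exact: le_lt_trans cx yx.
by rewrite RintegralZr// ler_wpM2r.
Qed.

End Duhamel.

(** * A bound for the slope, uniform in the amplitude *)

Section Bootstrap.
Context {R : realType}.
Implicit Types (s t x y z e r a b : R).
Local Notation mu := (@lebesgue_measure R).

(** The constant depends on nu only; it is kept abstract in what follows. *)
Lemma ddsemigroup_smoothing (nu : R) : 0 < nu ->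
  exists2 C, 0 < C & forall s f B y, 0 < s -> nu * s <= 1 -> continuous f ->
    (forall z, `|f z| <= B) -> `|ddsemigroup (nu * s) f y| <= C * B / qrt s ^+ 2.
Proof.
move=> nu0; exists (10000 / qrt nu ^+ 2).
  by apply: divr_gt0; [exact: ltr0Sn|rewrite exprn_gt0// qrt_gt0].
move=> s f B y s0 nus cf fB.
have p0 : 0 < nu * s by rewrite mulr_gt0.
have r1 : qrt (nu * s) <= 1 by rewrite -(@qrt1 R) le_qrt// ltW.
have := normr_ddsemigroup cf fB (qrt_gt0 p0) y r1.
rewrite qrtX4 ?(ltW p0)// => H; apply: le_trans H _.
have q1 := qrt_gt0 nu0; have q2 := qrt_gt0 s0.
have E c : c * B / (qrt nu * qrt s) ^+ 2 = c / qrt nu ^+ 2 * B / qrt s ^+ 2.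
  by field; rewrite !gt_eqF.
by rewrite (qrtM (ltW nu0) (ltW s0)) E.
Qed.

Lemma integral_affine_beta a b t : 0 < t -> 0 <= b ->
  mu.-integrable `]0, t[ (EFin \o (fun s => a + b * beta_kernel t s)) /\
  \int[mu]_(s in `]0, t[) (a + b * beta_kernel t s) <= a * t + b * (32 / qrt t).
Proof.
move=> t0 b0.
have i1 : mu.-integrable `]0, t[ (EFin \o (fun=> a)).
  apply/integrableP; split; first exact/measurable_EFinP/measurable_cst.
  rewrite /= integral_cst//= lebesgue_measure_itv/= lte_fin t0.
  by rewrite -?EFinB -EFinM ltry.
have i2 : mu.-integrable `]0, t[ (EFin \o (fun s => b * beta_kernel t s)).
  rewrite (_ : EFin \o _ = fun s => b%:E * (beta_kernel t s)%:E)%E.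
    by apply: integrableZl => //; exact: integrable_beta_kernel.
  by apply/funext => s; rewrite /= EFinM.
split.
  rewrite (_ : EFin \o _ = (EFin \o (fun=> a)) \+ (EFin \o (fun s => (b * beta_kernel t s)%R)))%E.
    exact: integrableD.
  by apply/funext => s; rewrite /= EFinD.
rewrite RintegralD// RintegralZl//; last exact: integrable_beta_kernel.
rewrite Rintegral_cst//= lebesgue_measure_itv/= lte_fin t0/=.
by rewrite subr0 lerD2l ler_wpM2l// Rintegral_beta_kernel.
Qed.

Variables (nu lam C : R) (h : R -> R -> R).
Hypotheses (nu0 : 0 < nu) (lam01 : 0 <= lam <= 1) (C0 : 0 < C).
Hypothesis mild : mild_solution nu (height0 lam) h.
Hypothesis smoothing : forall s f B y, 0 < s -> nu * s <= 1 -> continuous f ->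
    (forall z, `|f z| <= B) -> `|ddsemigroup (nu * s) f y| <= C * B / qrt s ^+ 2.

Let u t x := derive1 (h t) x.
Let W t x := wslope h t x.

(** The integral of the beta kernel contributes t^(-1/4), so that after
multiplication by t^(1/4) the bound is cubic in m up to a small linear term. *)
Lemma slope_near_linear t m x : 0 < t -> t <= 1 -> nu * t <= 1 ->
  (forall s x, 0 < s -> s <= t -> `|W s x| <= m) ->
  `|u t x - slope_lin nu t lam x| <= 32 * C * (m ^+ 3 + m * qrt t ^+ 2) / qrt t.
Proof.
move=> t0 t1 nut wm.
have m0 : 0 <= m by apply: le_trans (wm t 0 t0 (lexx t)).
have M0 : 0 <= m ^+ 3 + m * qrt t ^+ 2.
  by rewrite addr_ge0 ?mulr_ge0 ?exprn_ge0 ?qrt_ge0.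
have b0 : 0 <= C * (m ^+ 3 + m * qrt t ^+ 2) by rewrite mulr_ge0// ltW.
have [ig gG] := integral_affine_beta 0 t0 b0.
have E : 0 * t + C * (m ^+ 3 + m * qrt t ^+ 2) * (32 / qrt t) =
    32 * C * (m ^+ 3 + m * qrt t ^+ 2) / qrt t.
  by rewrite mul0r add0r; ring.
rewrite E in gG.
apply: (duhamel_slope nu0 mild t0 t1 nut wm
  (is_derive_semigroup_height0 nu t lam x) ig gG ltr01) => s y /andP[s0 st] _.
rewrite add0r.
have ts : 0 < t - s by rewrite subr_gt0.
have nts : nu * (t - s) <= 1.
  by apply: le_trans nut; rewrite ler_pM2l// gerBl ltW.
have fB z : `|flux h s z| <= (m ^+ 3 + m * qrt t ^+ 2) / qrt s ^+ 3.
  apply: le_trans (normr_flux _ s0 (fun x => wm s x s0 (ltW st))) _.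
  rewrite ler_wpM2r ?invr_ge0 ?exprn_ge0 ?qrt_ge0// lerD2l ler_wpM2l//.
  by rewrite lerXn2r ?nnegrE ?qrt_ge0// le_qrt// ltW.
apply: le_trans (smoothing y ts nts (continuous_flux mild s0) fB) _.
have q1 := qrt_gt0 s0; have q2 := qrt_gt0 ts.
by rewrite le_eqVlt; apply/orP; left; apply/eqP; rewrite /beta_kernel; field; rewrite !gt_eqF.
Qed.

Variable T : R.
Hypotheses (T0 : 0 < T) (T1 : T <= 1) (nuT : nu * T <= 1).
Hypothesis smallT : 32 * C * (26 * qrt T ^+ 2) <= 2^-1.

(** Under the smallness condition on T the nonlinear contribution to t^(1/4) u is
at most half of the bound that is assumed, hence it is absorbed.  What is left
is twice the linear contribution, which is at most half of the
threshold 5 T^(1/4). *)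
Lemma wslope_improve t : 0 < t -> t <= T ->
  (forall s x, 0 < s -> s <= t -> `|W s x| <= 5 * qrt T) ->
  forall s x, 0 < s -> s <= t -> `|W s x| <= 5 / 2 * qrt t.
Proof.
move=> t0 tT Wt s x s0 st.
pose E : set R := [set v | exists s x, [/\ 0 < s, s <= t & v = `|W s x|]].
have -> : 5 / 2 * qrt t = 2 * (5 / 4 * qrt t) by field.
apply: (@half_contraction _ E _ (5 * qrt T)); last by exists s, x.
- by exists `|W s x|, s, x.
- by move=> _ [r [y [r0 rt ->]]]; exact: Wt.
move=> m mT Em _ [r [y [r0 rt ->]]].
have wm s' x' : 0 < s' -> s' <= r -> `|W s' x'| <= m.
  by move=> a1 a2; apply: Em; exists s', x'; split => //; exact: le_trans rt.
have m0 : 0 <= m by apply: le_trans (wm r y r0 (lexx r)).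
have qr := qrt_gt0 r0.
have rT : r <= T := le_trans rt tT.
have r1 : r <= 1 := le_trans rT T1.
have nur : nu * r <= 1 by apply: le_trans nuT; rewrite ler_pM2l.
have H := slope_near_linear y r0 r1 nur wm.
have L : `|slope_lin nu r lam y| <= 5 / 4.
  by apply: normr_slope_lin => //; rewrite mulr_ge0// ltW.
have U : `|u r y| <= 5 / 4 + 32 * C * (m ^+ 3 + m * qrt r ^+ 2) / qrt r.
  rewrite -[u r y](subrK (slope_lin nu r lam y)) addrC.
  by apply: le_trans (ler_normD _ _) _; exact: lerD.
have -> : `|W r y| = `|u r y| * qrt r.
  by rewrite /W /wslope normrM ger0_norm ?qrt_ge0// mulrC.
apply: le_trans (ler_wpM2r (ltW qr) U) _.
have -> : (5 / 4 + 32 * C * (m ^+ 3 + m * qrt r ^+ 2) / qrt r) * qrt r =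
  5 / 4 * qrt r + m * (32 * C * (m ^+ 2 + qrt r ^+ 2)) by field; rewrite gt_eqF.
apply: lerD; first by rewrite ler_wpM2l// le_qrt// ltW.
rewrite ler_wpM2l//; apply: le_trans smallT.
have c0 : 0 <= 32 * C by rewrite mulr_ge0// ltW.
apply: (ler_wpM2l c0).
(* 26 = 5^2 + 1 bounds the sum of the two squares. *)
have a1 : m ^+ 2 <= (5 * qrt T) ^+ 2.
  by apply: lerXn2r => //; rewrite nnegrE// mulr_ge0// qrt_ge0.
have a2 : qrt r ^+ 2 <= qrt T ^+ 2.
  by apply: lerXn2r; rewrite ?nnegrE ?qrt_ge0// le_qrt// ltW.
by move: a1; rewrite exprMn; lra.
Qed.

(** Continuity argument: at the infimum i of the times at which the threshold is
exceeded, the bound improves to half of the threshold, and continuity in time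
then keeps it below the threshold slightly after i. *)
Lemma wslope_bounded s x : 0 < s -> s <= T -> `|W s x| <= 5 * qrt T.
Proof.
move=> s0 sT; rewrite leNgt; apply/negP => bad.
pose B : set R := [set r | [/\ 0 < r, r <= T & exists y, 5 * qrt T < `|W r y|]].
have B0 : B !=set0 by exists s; split => //; exists x.
have lB : lbound B 0 by move=> r [r0 _ _]; exact: ltW.
have iB : has_inf B by split => //; exists 0.
pose i := inf B.
have i0 : 0 <= i by exact: lb_le_inf.
have leB r : B r -> i <= r by move=> Br; exact: (ge_inf iB.2 Br).
have sB : B s by split => //; exists x.
have iT : i <= T := le_trans (leB _ sB) sT.
have good r y : 0 < r -> r < i -> `|W r y| <= 5 * qrt T.
  move=> r0 ri; rewrite leNgt; apply/negP => rbad.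
  have : i <= r.
    have rB : B r by split => //; [exact: le_trans (ltW ri) iT|exists y].
    exact: leB rB.
  by rewrite leNgt ri.
have qT := qrt_gt0 T0.
have Wi y : `|W i y| <= 5 / 2 * qrt T.
  move: i0; rewrite le_eqVlt => /predU1P[<-|ipos].
    by rewrite /W /wslope qrt0 mul0r normr0 mulr_ge0// ltW.
  have Wii z : `|W i z| <= 5 * qrt T.
    apply/ler_addgt0Pl => e e0.
    have [d d0 Hd] := wslope_time mild (ltW ipos) e0.
    (* A time before i, at which the bound is known, that is close to i. *)
    pose r := i - Num.min (d / 2) (i / 2).
    have mm : 0 < Num.min (d / 2) (i / 2) by rewrite lt_min !divr_gt0.
    have m1 : Num.min (d / 2) (i / 2) <= d / 2 by rewrite ge_min lexx.
    have m2 : Num.min (d / 2) (i / 2) <= i / 2 by rewrite ge_min lexx orbT.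
    have r0 : 0 < r by rewrite /r; lra.
    have ri : r < i by rewrite /r; lra.
    have rd : `|r - i| < d by rewrite /r addrAC subrr add0r normrN gtr0_norm//; lra.
    have := Hd r (ltW r0) rd z => H.
    rewrite -[W i z](subrK (W r z)); apply: le_trans (ler_normD _ _) _.
    by apply: lerD; [rewrite distrC ltW|exact: good].
  have Wle r z : 0 < r -> r <= i -> `|W r z| <= 5 * qrt T.
    by move=> r0; rewrite le_eqVlt => /predU1P[->|]; [exact: Wii|exact: good].
  apply: le_trans (wslope_improve ipos iT Wle y ipos (lexx i)) _.
  by rewrite ler_wpM2l// le_qrt// ltW.
have e0 : 0 < 5 / 2 * qrt T by rewrite mulr_gt0.
have [d d0 Hd] := wslope_time mild i0 e0.
have [r [r0 rT [y ry]] rid] := inf_adherent d0 iB.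
have rB : B r by split => //; exists y.
have ir : i <= r by exact: leB rB.
have := Hd r (ltW r0); rewrite ger0_norm ?subr_ge0// ltrBlDl => /(_ rid y) H.
have : `|W r y| <= 5 * qrt T.
  rewrite -[W r y](subrK (W i y)); apply: le_trans (ler_normD _ _) _.
  by have := Wi y; move: H; rewrite -/(W r y) -/(W i y); lra.
by rewrite leNgt ry.
Qed.

Lemma slope_bounded t x : 0 < t -> t <= T -> `|u t x| <= 5 / 2.
Proof.
move=> t0 tT; have qt := qrt_gt0 t0.
have Wt r y : 0 < r -> r <= t -> `|W r y| <= 5 * qrt T.
  by move=> r0 rt; apply: wslope_bounded => //; exact: le_trans tT.
have := wslope_improve t0 tT Wt x t0 (lexx t).
by rewrite /W /wslope normrM ger0_norm ?qrt_ge0// mulrC ler_pM2r.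
Qed.

End Bootstrap.

(** * Expansion of the slope for small times *)

Section SecondStep.
Context {R : realType}.
Implicit Types (s t x y z e r a b d phi : R).
Local Notation mu := (@lebesgue_measure R).
Variables (nu lam C : R) (h : R -> R -> R).
Hypotheses (nu0 : 0 < nu) (lam01 : 0 <= lam <= 1) (C0 : 0 < C).
Hypothesis mild : mild_solution nu (height0 lam) h.
Hypothesis smoothing : forall s f B y, 0 < s -> nu * s <= 1 -> continuous f ->
    (forall z, `|f z| <= B) -> `|ddsemigroup (nu * s) f y| <= C * B / qrt s ^+ 2.
Variable T : R.
Hypotheses (T0 : 0 < T) (T1 : T <= 1) (nuT : nu * T <= 1).
Hypothesis smallT : 32 * C * (26 * qrt T ^+ 2) <= 2^-1.

Let u t x := derive1 (h t) x.
Let flux0 := trig (@flux0_coef R lam) 0 10.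

Let ub s x : 0 < s -> s <= T -> `|u s x| <= 5 / 2.
Proof.
exact: (slope_bounded nu0 lam01 C0 mild smoothing T0 T1 nuT smallT).
Qed.

Let flux0E z : flux0 z = slope0 lam z ^+ 3 - slope0 lam z.
Proof. by rewrite /flux0 -flux0_trig. Qed.

Let slope0_le1 z : `|slope0 lam z| <= 1.
Proof.
by case/andP: lam01 => l0 l1; apply: le_trans l1; exact: normr_slope0.
Qed.

Lemma flux_lipschitz s phi z : 0 < s -> s <= T -> `|u s z - slope0 lam z| <= phi ->
  `|flux h s z - flux0 z| <= 11 * phi.
Proof.
move=> s0 sT H; rewrite flux0E /flux -/(u s z).
have := ub z s0 sT; have := slope0_le1 z.
move: (slope0 lam z) (u s z) H => b a H b1 a1.
have -> : a ^+ 3 - a - (b ^+ 3 - b) = (a ^+ 2 + a * b + b ^+ 2 - 1) * (a - b) by ring.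
rewrite normrM ler_pM//.
move: b1 a1; rewrite !ler_norml => /andP[b1 b2] /andP[a1 a2].
by apply/andP; split; nra.
Qed.

(** The flux is split into its initial value, on which d_xx S is bounded by a near
x, and a difference of size 11 phi, on which the smoothing bound is used. *)
Lemma slope_duhamel t phi a d x : 0 < t -> t <= T -> 0 < d -> 0 <= phi ->
  (forall s z, 0 < s -> s <= t -> `|u s z - slope0 lam z| <= phi) ->
  (forall s y, 0 < s < t -> `|y - x| < d -> `|ddsemigroup (nu * (t - s)) flux0 y| <= a) ->
  `|u t x - slope_lin nu t lam x| <= a * t + 352 * C * phi * qrt t ^+ 2.
Proof.
move=> t0 tT d0 phi0 Hphi Ha.
have t1 : t <= 1 := le_trans tT T1.
have nut : nu * t <= 1 by apply: le_trans nuT; rewrite ler_pM2l.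
have qt := qrt_gt0 t0.
have wm s y : 0 < s -> s <= t -> `|wslope h s y| <= 5 / 2.
  move=> s0 st; rewrite /wslope normrM ger0_norm ?qrt_ge0// -[leRHS]mul1r.
  rewrite ler_pM ?qrt_ge0//; last by apply: ub => //; exact: le_trans tT.
  by rewrite -(@qrt1 R) le_qrt ?(ltW s0)//; exact: le_trans t1.
pose b := C * (11 * phi) * qrt t ^+ 3.
have b0 : 0 <= b.
  by apply: mulr_ge0; [apply: mulr_ge0; [exact: ltW|exact: mulr_ge0]|rewrite exprn_ge0// ltW].
have [ig gG] := integral_affine_beta a t0 b0.
have E : a * t + b * (32 / qrt t) = a * t + 352 * C * phi * qrt t ^+ 2.
  by rewrite /b; field; rewrite gt_eqF.
rewrite E in gG.
apply: (duhamel_slope nu0 mild t0 t1 nut wm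
  (is_derive_semigroup_height0 nu t lam x) ig gG d0) => s y st yx.
have /andP[s0 st'] := st.
have ts : 0 < t - s by rewrite subr_gt0.
have nts : nu * (t - s) <= 1.
  by apply: le_trans nut; rewrite ler_pM2l// gerBl ltW.
have nts0 : 0 < nu * (t - s) by rewrite mulr_gt0.
have cf := continuous_flux mild s0.
have c0 : continuous flux0 by exact: continuous_trig.
have cd : continuous (fun z => flux h s z - flux0 z).
  by move=> z; apply: cvgB; [exact: cf|exact: c0].
have dB z : `|flux h s z - flux0 z| <= 11 * phi.
  by apply: flux_lipschitz => //; [exact: le_trans (ltW st') tT|apply: Hphi => //; exact: ltW].
have f0B z : `|flux0 z| <= 2.
  rewrite flux0E; apply: le_trans (ler_normB _ _) _; rewrite normrX.
  have n0 := slope0_le1 z.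
  have n3 : `|slope0 lam z| ^+ 3 <= 1 by rewrite exprn_ile1.
  by lra.
have -> : flux h s = fun z => flux0 z + (flux h s z - flux0 z).
  by apply/funext => z; rewrite addrC subrK.
rewrite -[nu * (t - s)](qrtX4 (ltW nts0)).
rewrite (ddsemigroupD y (qrt_gt0 nts0) c0 cd f0B dB) (qrtX4 (ltW nts0)).
apply: le_trans (ler_normD _ _) _; apply: lerD; first exact: Ha.
apply: le_trans (smoothing y ts nts cd dB) _.
have q1 := qrt_gt0 s0; have q2 := qrt_gt0 ts.
rewrite /b /beta_kernel.
have -> : C * (11 * phi) * qrt t ^+ 3 * (qrt s ^+ 3 * qrt (t - s) ^+ 2)^-1 =
   C * (11 * phi) / qrt (t - s) ^+ 2 * (qrt t ^+ 3 / qrt s ^+ 3).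
  by field; rewrite !gt_eqF.
rewrite ler_peMr//.
  apply: divr_ge0; last by rewrite exprn_ge0// ltW.
  by apply: mulr_ge0; [exact: ltW|exact: mulr_ge0].
rewrite ler_pdivlMr ?exprn_gt0// mul1r lerXn2r ?nnegrE ?qrt_ge0//.
by rewrite le_qrt// ltW.
Qed.

(** Here phi is absorbed for small T, and the initial flux is smooth, so that its
contribution is O(t). *)
Lemma slope_near_slope0 t x : 0 < t -> t <= T ->
  `|u t x - slope0 lam x| <= 2 * ((12 * nu + 1620) * t).
Proof.
move=> t0 tT.
pose E : set R := [set v | exists s x, [/\ 0 < s, s <= t & v = `|u s x - slope0 lam x|]].
apply: (@half_contraction _ E _ (7 / 2)); last by exists t, x.
- by exists `|u t x - slope0 lam x|, t, x.
- move=> _ [r [y [r0 rt ->]]]; apply: le_trans (ler_normB _ _) _.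
  by have := ub y r0 (le_trans rt tT); have := slope0_le1 y; lra.
move=> m _ Em _ [r [y [r0 rt ->]]].
have rT := le_trans rt tT.
have wm s' x' : 0 < s' -> s' <= r -> `|u s' x' - slope0 lam x'| <= m.
  by move=> a1 a2; apply: Em; exists s', x'; split => //; exact: le_trans rt.
have m0 : 0 <= m by apply: le_trans (wm r y r0 (lexx r)).
have Ha s z : 0 < s < r -> `|z - y| < 1 -> `|ddsemigroup (nu * (r - s)) flux0 z| <= 1620.
  move=> /andP[s0 sr] _; apply: normr_ddsemigroup_trig.
    by rewrite mulr_ge0 ?subr_ge0 ?ltW.
  by move=> k; exact: normr_flux0_coef.
have H1 := slope_duhamel r0 rT ltr01 m0 wm Ha.
have H2 : `|slope_lin nu r lam y - slope0 lam y| <= 12 * (nu * r).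
  by apply: slope_lin_slope0 => //; rewrite mulr_ge0// ltW.
rewrite -[u r y](subrK (slope_lin nu r lam y)) -addrA.
apply: le_trans (ler_normD _ _) _; apply: le_trans (lerD H1 H2) _.
have q2 : qrt r ^+ 2 <= qrt T ^+ 2.
  by apply: lerXn2r; rewrite ?nnegrE ?qrt_ge0// le_qrt// ltW.
have c1 : 352 * C * m * qrt r ^+ 2 <= m / 2.
  have p0 : 0 <= C * qrt r ^+ 2 by rewrite mulr_ge0 ?(ltW C0)// exprn_ge0// qrt_ge0.
  have p1 : C * qrt r ^+ 2 <= C * qrt T ^+ 2 by rewrite ler_pM2l.
  have p2 : 352 * (C * qrt r ^+ 2) <= 2^-1 by move: smallT p1 p0; lra.
  have -> : 352 * C * m * qrt r ^+ 2 = m * (352 * (C * qrt r ^+ 2)) by ring.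
  by rewrite ler_wpM2l.
have c2 : nu * r <= nu * t by rewrite ler_pM2l.
have -> : (12 * nu + 1620) * t = 12 * (nu * t) + 1620 * t by ring.
by lra.
Qed.

(** With phi = O(t) from [slope_near_slope0] the error gains a factor t^(1/2) over
t, and so does the contribution of the initial flux near x = 0. *)
Lemma slope_at0 t M : 0 < t -> t <= T ->
  (forall s y, 0 <= s -> `|ddsemigroup s flux0 y| <= M * (s + `|y|)) -> 0 <= M ->
  slope_lin nu t lam 0 - t * qrt t ^+ 2 * (M * (nu + 1) + 704 * C * (12 * nu + 1620)) <=
  u t 0.
Proof.
move=> t0 tT HM M0.
have K0 : 0 <= 12 * nu + 1620 by apply: addr_ge0; [apply: mulr_ge0 => //; exact: ltW|exact: ler0n].
have phi0 : 0 <= 2 * ((12 * nu + 1620) * t) by exact: (mulr_ge0 (ler0n _ 2) (mulr_ge0 K0 (ltW t0))).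
have Hphi s z : 0 < s -> s <= t -> `|u s z - slope0 lam z| <= 2 * ((12 * nu + 1620) * t).
  move=> s0 st; apply: le_trans (slope_near_slope0 z s0 (le_trans st tT)) _.
  exact: (ler_wpM2l (ler0n _ 2) (ler_wpM2l K0 st)).
have Ha s y : 0 < s < t -> `|y - 0| < t ->
    `|ddsemigroup (nu * (t - s)) flux0 y| <= M * ((nu + 1) * t).
  move=> /andP[s0 st]; rewrite subr0 => yt.
  have ts0 : 0 <= nu * (t - s) by rewrite mulr_ge0 ?subr_ge0 ?ltW.
  apply: le_trans (HM _ y ts0) _; apply: ler_wpM2l => //.
  rewrite mulrDl mul1r; apply: lerD; last exact: ltW.
  by rewrite ler_pM2l// gerBl ltW.
have := slope_duhamel t0 tT t0 phi0 Hphi Ha.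
have t1 : t <= 1 := le_trans tT T1.
have tq : t <= qrt t ^+ 2.
  rewrite -[leLHS](qrtX4 (ltW t0)) ler_wiXn2l ?qrt_ge0//.
  by rewrite -(@qrt1 R) le_qrt// ltW.
have X : M * ((nu + 1) * t) * t <= M * ((nu + 1) * t) * qrt t ^+ 2.
  exact: (ler_wpM2l (mulr_ge0 M0 (mulr_ge0 (addr_ge0 (ltW nu0) ler01) (ltW t0))) tq).
rewrite ler_norml => /andP[H _]; move: H X.
move: (12 * nu + 1620) K0 => K K0.
by lra.
Qed.

End SecondStep.

(** * The overshoot *)

(** Here w stands for nu t, and lam is 1 - w; the linear growth 9 lam w makes up
for the loss w of amplitude and for errors of size w. *)
Lemma growth_beats_error (R : realFieldType) (w X Y P Q : R) :
  0 < w -> w <= 1 / 2 -> 0 <= X -> X <= Y * Q -> Y * (P + Q) <= w ->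
  1 < (1 - w) * (1 + 9 * w - X) - Y * P.
Proof.
move=> w0 w2 X0 XQ; rewrite mulrDr => PQ.
have a3 : (1 - w) * X <= X by rewrite ler_piMl// gerBl ltW.
have a4 : 1 + 7 / 2 * w <= (1 - w) * (1 + 9 * w) by nra.
by rewrite mulrBr; lra.
Qed.

(** The time t is fixed before the amplitude: the bounds above are uniform in
lam, so lam = 1 - nu t may depend on t. *)
Lemma overshoot (R : realType) (nu : R) : 0 < nu ->
  exists2 t : R, 0 < t <= 1 /\ nu * t <= 1 / 2 &
    forall h, mild_solution nu (height0 (1 - nu * t)) h -> 1 < derive1 (h t) 0.
Proof.
move=> nu0.
have [C C0 smoothing] := ddsemigroup_smoothing nu0.
pose M : R := 10 * (162 * 6561).
have M0 : 0 <= M by exact: (mulr_ge0 (ler0n _ _) (mulr_ge0 (ler0n _ _) (ler0n _ _))).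
have HM lam s y : 0 <= lam <= 1 -> 0 <= s ->
    `|ddsemigroup s (trig (flux0_coef lam) 0 10) y| <= M * (s + `|y|).
  move=> lam01 s0; apply: ddsemigroup_trig_near0 => //.
    by move=> k; exact: normr_flux0_coef.
  exact: flux0_coef_moment.
clearbody M.
have [D D0 DE] : exists2 D, 0 <= D &
    M * (nu + 1) + 704 * C * (12 * nu + 1620) + 821 * nu ^+ 2 = D.
  eexists; last reflexivity.
  have n0 := ltW nu0.
  apply: addr_ge0; last exact: (mulr_ge0 (ler0n _ _) (sqr_ge0 _)).
  apply: addr_ge0; first exact: (mulr_ge0 M0 (addr_ge0 n0 ler01)).
  apply: mulr_ge0; first exact: (mulr_ge0 (ler0n _ _) (ltW C0)).
  exact: (addr_ge0 (mulr_ge0 (ler0n _ _) n0) (ler0n _ _)).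
(* Each summand X of S yields a smallness condition X * eta <= 1, where eta is
   the value of qrt t ^+ 2. *)
pose S := 1 + 2 * nu + 32 * C * 52 + D / nu.
have s1 : 0 <= 2 * nu by rewrite mulr_ge0// ltW.
have s2 : 0 <= 32 * C * 52 by rewrite !mulr_ge0// ltW.
have s3 : 0 <= D / nu by rewrite divr_ge0// ltW.
have S0 : 0 < S by rewrite /S; lra.
pose eta := S^-1.
have e0 : 0 < eta by rewrite invr_gt0.
have small X : X <= S -> X * eta <= 1 by move=> XS; rewrite ler_pdivrMr// mul1r.
have e1 : eta <= 1 by rewrite -[eta]mul1r; apply: small; rewrite /S; lra.
have e2 : 2 * nu * eta <= 1 by apply: small; rewrite /S; lra.
have e3 : 32 * C * 52 * eta <= 1 by apply: small; rewrite /S; lra.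
have e4 : D / nu * eta <= 1 by apply: small; rewrite /S; lra.
have e5 : D * eta <= nu by move: e4; rewrite mulrAC ler_pdivrMr// mul1r.
pose t := eta ^+ 2.
have t0 : 0 < t by rewrite exprn_gt0.
have te : t <= eta by rewrite /t expr2 ler_piMr// ltW.
have t1 : t <= 1 := le_trans te e1.
have nt : nu * t <= 1 / 2.
  have : nu * t <= nu * eta by rewrite ler_pM2l.
  by move: e2; lra.
have qt : qrt t ^+ 2 = eta.
  apply: (@pexpIrn _ 2); rewrite ?nnegrE ?exprn_ge0 ?qrt_ge0 ?(ltW e0)//.
  by rewrite -exprM qrtX4// ltW.
have nt0 : 0 < nu * t by rewrite mulr_gt0.
have nt1 : nu * t <= 1 by apply: le_trans nt _; rewrite mul1r invf_le1// ler1n.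
have lam01 : 0 <= 1 - nu * t <= 1 by rewrite subr_ge0 nt1 gerBl ltW.
exists t; first by rewrite t0 t1.
move=> h mild.
have smallt : 32 * C * (26 * qrt t ^+ 2) <= 2^-1 by rewrite qt; move: e3; lra.
have := slope_at0 nu0 lam01 C0 mild smoothing t0 t1 nt1 smallt t0 (lexx t) (fun s y => HM _ s y lam01) M0.
have l0 : 0 <= 1 - nu * t by case/andP: lam01.
have := slope_lin0_ge (ltW nt0) l0.
rewrite qt => L1 L2; apply: lt_le_trans L2; apply: lt_le_trans (lerB L1 (lexx _)).
apply: (@growth_beats_error _ _ _ _ _ (821 * nu ^+ 2) nt0 nt).
- exact: (mulr_ge0 (ler0n _ _) (sqr_ge0 _)).
- have -> : 821 * (nu * t) ^+ 2 = t * t * (821 * nu ^+ 2) by ring.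
  apply: ler_wpM2r; first exact: (mulr_ge0 (ler0n _ _) (sqr_ge0 _)).
  by rewrite ler_pM2l.
- by rewrite DE -mulrA [leRHS]mulrC ler_pM2l// mulrC.
Qed.

Unset Implicit Arguments.

Theorem theorem1p2 (R : realType) (nu : R) (nu_gt0 : 0 < nu) :
  exists A : set (R -> R),
    [/\ A !=set0,
        (forall h0, A h0 -> circle_fun h0 /\ smooth h0),
        (forall h0, A h0 ->
           circle_int h0 = 0 /\ (Linf_norm (derive1 h0) < 1)%E)
      & (forall h0, A h0 ->
           exists t0 : R, 0 < t0 /\
             forall h : R -> R -> R, mild_solution nu h0 h ->
               (1 < Linf_norm (derive1 (h t0)))%E)].
Proof.
have [t [/andP[t0 t1] nt] H] := @overshoot R nu nu_gt0.
have nt0 : 0 < nu * t by rewrite mulr_gt0.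
exists [set height0 (1 - nu * t)]; split.
- by exists (height0 (1 - nu * t)).
- by move=> _ ->; split; [exact: circle_fun_height0|exact: smooth_height0].
- move=> _ ->; split; first exact: circle_int_height0.
  apply: (@le_lt_trans _ _ (1 - nu * t)%:E); last by rewrite lte_fin ltrBlDr ltrDl.
  by apply: Linf_norm_le => x; rewrite derive1_height0; apply: normr_slope0; lra.
- move=> _ ->; exists t; split=> // h mild.
  apply: (@Linf_norm_gt _ _ 0); first exact: (continuous_slope mild t0).
  exact: lt_le_trans (H h mild) (ler_norm _).
Qed.
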